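(* Let $(U,\mathrm{dist})$ be a metric space of doubling dimension $D$, let $S\subseteq U$ be a finite set with aspect ratio $\Delta$, let $k\le|S|$ be a positive integer and $\epsilon>0$. Consider one of the diversity measures remote-edge, remote-clique, remote-star, remote-bipartition, remote-tree, remote-cycle, with the associated approximation factor $\alpha_{\mathrm{div}}$ (respectively $2,2,2,3,4,3$), and let $A_{\mathrm{div}}$ be a polynomial-time algorithm achieving approximation factor $\alpha_{\mathrm{div}}$ for the corresponding diversity maximization problem, with running time $t_{A_{\mathrm{div}}}(\cdot)$ as a function of input size. Given a cover tree $T$ for $S$ (augmented with respect to the $k$-bounded cardinality matroid $M_{k,S}$ for the remote-clique, remote-star, remote-bipartition and remote-tree variants), one can compute a set $C\subseteq S$ of size $k$ with $\mathrm{div}(C)\ge \mathrm{div}^*_k(S)/(\alpha_{\mathrm{div}}+O(\epsilon))$ in time $O\big(t_{A_{\mathrm{div}}}(k(64/\epsilon)^D)+k\log\Delta\big)$ for the remote-edge and remote-cycle variants, and in time $O\big(t_{A_{\mathrm{div}}}(k^2(64/\epsilon)^D)+k\log\Delta\big)$ for the other variants.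
   Context: The doubling dimension of $(U,\mathrm{dist})$ is the minimum $D\ge0$ such that every ball $B(p,r)=\{q\in U:\mathrm{dist}(p,q)\le r\}$ is contained in the union of at most $2^D$ balls of radius $r/2$ centered at points of $U$. The aspect ratio of $S$ is $\Delta=d_{\max}/d_{\min}$, the ratio of the maximum and minimum distances between two distinct points of $S$. Diversity measures for $X\subseteq S$ (with $d=\mathrm{dist}$): remote-edge $\min_{p,q\in X}d(p,q)$; remote-clique $\sum_{p,q\in X}d(p,q)$; remote-star $\min_{c\in X}\sum_{q\in X\setminus\{c\}}d(c,q)$; remote-bipartition $\min_{Q\subset X,|Q|=\lfloor|X|/2\rfloor}\sum_{q\in Q,z\in X\setminus Q}d(q,z)$; remote-tree: weight of a minimum spanning tree of the complete graph on $X$ with edge weights $d$; remote-cycle: weight of a minimum Hamiltonian cycle of that graph. The diversity maximization problem asks for $C\subseteq S$, $|C|=k$, maximizing $\mathrm{div}(C)$; $\mathrm{div}^*_k(S)$ is the optimum, and an $\alpha$-approximation returns $C$ with $\mathrm{div}(C)\ge\mathrm{div}^*_k(S)/\alpha$. The $k$-bounded cardinality matroid $M_{k,S}$ has as independent sets all subsets of $S$ of size at most $k$. A cover tree $T$ for $S$ is a rooted tree with levels indexed by integers decreasing from the root; $T_\ell$ is the set of nodes at level $\ell$, each node $u$ is associated with a point $u.\mathrm{point}\in S$, the points of the nodes of $T_\ell$ are distinct, and every non-root node of $T_\ell$ has a parent in $T_{\ell+1}$. Writing $\mathrm{dist}(u,v)=\mathrm{dist}(u.\mathrm{point},v.\mathrm{point})$,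 for every level $\ell$: (1) the points of $T_\ell$ are contained in the points of $T_{\ell-1}$; (2) $\mathrm{dist}(u,u.\mathrm{parent})\le 2^{\ell+1}$ for $u\in T_\ell$; (3) $\mathrm{dist}(u,v)>2^\ell$ for distinct $u,v\in T_\ell$. In the explicit representation, maximal chains of same-point nodes each having only the same-point child are coalesced into a single node. An augmented cover tree with respect to a matroid $M$ stores at each node $u$ the value $|S_u|$ and a maximal independent set of the restriction of $M$ to $S_u$, where $S_u$ is the set of points associated with nodes in the subtree rooted at $u$.
   Formalization: The factor (64/ε)^D is replaced by max(1, 64/ε)^D, since for ε > 64 the stated time can be below the k steps needed to output C (n equidistant points, k = n); the running time t_A is taken to be nondecreasing with t_A(n) ≥ n. *)

(* Defs.v *)
(* MathComp with MathComp-Analysis and finmap. *)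
From Stdlib Require List.
From HB Require Import structures.
From mathcomp Require Export all_boot all_order all_algebra finmap.
From mathcomp Require Export all_classical all_reals all_analysis.

Set Implicit Arguments.
Unset Strict Implicit.
Unset Printing Implicit Defensive.

Export Order.TTheory GRing.Theory Num.Theory.

Global Open Scope classical_set_scope.
Global Open Scope fset_scope.
Global Open Scope ring_scope.

(** * Metric notions *)

(* The library's [ball] is open; the covering condition is about closed balls. *)
Definition closed_mball (R : realType) (U : metricType R) (p : U) (r : R) :
    set U :=
  [set q | mdist p q <= r].

Definition doubling (R : realType) (U : metricType R) (D : R) : Prop :=
  forall (p : U) (r : R), exists cs : seq U,
    (size cs)%:R <= 2 `^ D /\
    forall q, closed_mball p r q -> exists2 c, c \in cs & closed_mball c (r / 2) q.

Definition doubling_dimension (R : realType) (U : metricType R) (D : R) : Prop :=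
  [/\ 0 <= D, doubling U D & forall D', 0 <= D' -> doubling U D' -> D <= D'].

(* All the [inf] and [sup] below range over finite sets of reals, so that they
   are minima and maxima; over an empty set (e.g. the distances between two
   distinct points of a singleton) they are 0. *)

Definition distances (R : realType) (U : metricType R) (X : {fset U}) : set R :=
  [set d | exists p q, [/\ p \in X, q \in X, p != q & d = mdist p q]].

Definition aspect_ratio (R : realType) (U : metricType R) (S : {fset U}) : R :=
  sup (distances S) / inf (distances S).

(** * Diversity measures *)

Definition remote_edge (R : realType) (U : metricType R) (X : {fset U}) : R :=
  inf (distances X).

(* Every unordered pair is counted twice; the factor 2 does not affect
   approximation ratios. *)
Definition remote_clique (R : realType) (U : metricType R) (X : {fset U}) : R :=
  \sum_(p <- X) \sum_(q <- X) mdist p q.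

Definition remote_star (R : realType) (U : metricType R) (X : {fset U}) : R :=
  inf [set \sum_(q <- X `\ c) mdist c q | c in [set` X]].

Definition remote_bipartition (R : realType) (U : metricType R) (X : {fset U}) :
    R :=
  inf [set \sum_(q <- Q) \sum_(z <- X `\` Q) mdist q z
      | Q in [set Q : {fset U} | Q `<=` X /\ #|` Q| = #|` X|./2]].

(* A spanning tree of the complete graph on X is given by its adjacency
   relation.  A [ucycle] of size 2 is an edge walked back and forth. *)
Definition spanning_tree (U : choiceType) (X : {fset U}) (e : rel U) : Prop :=
  [/\ forall p q, e p q -> [/\ p \in X, q \in X & p != q],
      symmetric e,
      forall p q, p \in X -> q \in X -> exists s, path e p s /\ last p s = q
    & forall s, ucycle e s -> (size s <= 2)%N].

Definition tree_weight (R : realType) (U : metricType R) (X : {fset U})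
    (e : rel U) : R :=
  (\sum_(p <- X) \sum_(q <- X | e p q) mdist p q) / 2.

Definition remote_tree (R : realType) (U : metricType R) (X : {fset U}) : R :=
  inf [set tree_weight X e | e in [set e | spanning_tree X e]].

(* On two points the Hamiltonian cycle goes back and forth. *)
Definition remote_cycle (R : realType) (U : metricType R) (X : {fset U}) : R :=
  inf [set \sum_(p <- s) mdist p (next s p)
      | s in [set s : seq U | uniq s /\ s =i X]].

Inductive measure : Type :=
  RemoteEdge | RemoteClique | RemoteStar | RemoteBipartition
| RemoteTree | RemoteCycle.

Definition div (R : realType) (U : metricType R) (m : measure) :
    {fset U} -> R :=
  match m with
  | RemoteEdge => @remote_edge R U
  | RemoteClique => @remote_clique R U
  | RemoteStar => @remote_star R U
  | RemoteBipartition => @remote_bipartition R U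
  | RemoteTree => @remote_tree R U
  | RemoteCycle => @remote_cycle R U
  end.

Definition alpha (m : measure) : nat :=
  match m with
  | RemoteEdge | RemoteClique | RemoteStar => 2
  | RemoteBipartition | RemoteCycle => 3
  | RemoteTree => 4
  end.

Definition uses_augmentation (m : measure) : bool :=
  match m with
  | RemoteEdge | RemoteCycle => false
  | RemoteClique | RemoteStar | RemoteBipartition | RemoteTree => true
  end.

Definition div_opt (R : realType) (U : metricType R) (m : measure) (k : nat)
    (S : {fset U}) : R :=
  sup [set div m C | C in [set C : {fset U} | C `<=` S /\ #|` C| = k]].

(** * Cover trees *)

(* The points of the nodes of a level are distinct, so a node is identified by
   its level and its point: [ct_level T l] is the set of points of T_l, and
   [ct_parent T l p] is the point of the parent, in T_(l+1), of the node of T_l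
   with point p. *)
Record cover_tree (U : choiceType) := CoverTree {
  ct_top : int;
  ct_level : int -> {fset U};
  ct_parent : int -> U -> U
}.

Record is_cover_tree (R : realType) (U : metricType R) (S : {fset U})
    (T : cover_tree U) : Prop := IsCoverTree {
  ct_root : exists r, ct_level T (ct_top T) = [fset r];
  ct_above : forall l : int, ct_top T < l -> ct_level T l = fset0;
  ct_sub : forall l, ct_level T l `<=` S;
  ct_all : forall p, p \in S -> exists l, p \in ct_level T l;
  ct_parentP : forall (l : int) p, l < ct_top T -> p \in ct_level T l ->
    ct_parent T l p \in ct_level T (l + 1);
  ct_nesting : forall l, ct_level T l `<=` ct_level T (l - 1);
  ct_covering : forall (l : int) p, l < ct_top T -> p \in ct_level T l ->
    mdist p (ct_parent T l p) <= 2 ^ (l + 1);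
  ct_separation : forall l p q, p \in ct_level T l -> q \in ct_level T l ->
    p != q -> 2 ^ l < mdist p q
}.

Definition ct_children (U : choiceType) (T : cover_tree U) (l : int) (p : U) :
    {fset U} :=
  [fset q in ct_level T (l - 1) | ct_parent T (l - 1) q == p].

(* A node of the explicit representation: point, level (the highest one, for a
   coalesced chain), optional augmentation, list of children. *)
Inductive xtree (U : Type) : Type :=
  XNode of U & int & option (nat * seq U) & seq (xtree U).

Definition xpoint (U : Type) (t : xtree U) : U := let: XNode p _ _ _ := t in p.

(* [explicit_at T l p t]: t explicitly represents the subtree of T rooted at the
   node of level l with point p, that node being the highest one of its chain.
   The levels of T are unbounded below, and a leaf of the explicit
   representation is an infinite chain. *)
Inductive explicit_at (U : choiceType) (T : cover_tree U) :
    int -> U -> xtree U -> Prop :=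
| ExplicitLeaf (l : int) p a :
    (forall j : int, j <= l -> ct_children T j p = [fset p]) ->
    explicit_at T l p (XNode p l a [::])
| ExplicitChain (l : int) p a (lo : int) t :
    lo <= l ->
    (forall j : int, lo <= j <= l -> ct_children T j p = [fset p]) ->
    ct_children T (lo - 1) p <> [fset p] ->
    explicit_at T (lo - 1) p t ->
    explicit_at T l p (XNode p l a [:: t])
| ExplicitBranch l p a ts :
    ct_children T l p <> [fset p] ->
    uniq (map (@xpoint U) ts) ->
    map (@xpoint U) ts =i ct_children T l p ->
    (forall t, List.In t ts -> explicit_at T (l - 1) (xpoint t) t) ->
    explicit_at T l p (XNode p l a ts).

Definition explicit (U : choiceType) (T : cover_tree U) (t : xtree U) : Prop :=
  ct_level T (ct_top T) = [fset xpoint t] /\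
  explicit_at T (ct_top T) (xpoint t) t.

Fixpoint subtree_points (U : choiceType) (t : xtree U) : {fset U} :=
  let: XNode p _ _ ts := t in
  p |` foldr (fun t' X => subtree_points t' `|` X) fset0 ts.

Definition maximal_independent (U : choiceType) (indep : set {fset U})
    (X I : {fset U}) : Prop :=
  [/\ I `<=` X, indep I & forall J : {fset U},
      I `<=` J -> J `<=` X -> indep J -> J = I].

(* Independent sets of the k-bounded cardinality matroid. *)
Definition bounded_card (U : choiceType) (k : nat) (S : {fset U}) :
    set {fset U} :=
  [set X | X `<=` S /\ (#|` X| <= k)%N].

Fixpoint augmented (U : choiceType) (indep : set {fset U}) (t : xtree U) :
    Prop :=
  let: XNode _ _ a ts := t in
  (exists B : seq U, [/\ a = Some (#|` subtree_points t|, B), uniq B &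
     maximal_independent indep (subtree_points t) [fset q in B]]) /\
  foldr (fun t' P => augmented indep t' /\ P) True ts.

(** * The model of computation *)

(* Algorithms are programs of a call-by-value language with recursive
   functions, pairs and mutable arrays, over integers, reals and opaque points
   whose only operation is the distance oracle.  Every evaluation step has unit
   cost, except that allocating an array costs its length.  Programs mention
   neither the metric space nor the reals, apart from integer constants. *)

Inductive prim : Type :=
  IAdd | ISub | ILe
| RAdd | RSub | RMul | RDiv | RLe
| Dist.

(* Variables are de Bruijn indices.  [EFun e] binds in e its argument (0) and
   itself (1).  [EMatch e e0 e1] goes to e0 on nil; on a pair it goes to e1,
   where it binds the first (0) and the second (1) components. *)
Inductive expr : Type :=
| EVar of nat
| EFun of expr
| EApp of expr & expr
| ELet of expr & expr
| EIf of expr & expr & expr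
| EInt of int
| EReal of int
| EPrim of prim & expr & expr
| ENil
| EPair of expr & expr
| EMatch of expr & expr & expr
| ENew of expr & expr
| EGet of expr & expr
| ESet of expr & expr & expr.

Inductive val (R U : Type) : Type :=
| VBool of bool
| VInt of int
| VReal of R
| VPoint of U
| VNil
| VPair of val R U & val R U
| VArr of nat
| VClos of seq (val R U) & expr.

Arguments VBool {R U} _.
Arguments VInt {R U} _.
Arguments VReal {R U} _.
Arguments VPoint {R U} _.
Arguments VNil {R U}.
Arguments VArr {R U} _.

Definition prim_sem (R : realType) (U : metricType R) (o : prim)
    (v w : val R U) : option (val R U) :=
  match o, v, w with
  | IAdd, VInt a, VInt b => Some (VInt (a + b))
  | ISub, VInt a, VInt b => Some (VInt (a - b))
  | ILe, VInt a, VInt b => Some (VBool (a <= b))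
  | RAdd, VReal a, VReal b => Some (VReal (a + b))
  | RSub, VReal a, VReal b => Some (VReal (a - b))
  | RMul, VReal a, VReal b => Some (VReal (a * b))
  | RDiv, VReal a, VReal b => Some (VReal (a / b))
  | RLe, VReal a, VReal b => Some (VBool (a <= b))
  | Dist, VPoint p, VPoint q => Some (VReal (mdist p q))
  | _, _, _ => None
  end.

(* Arrays are never deallocated: an address is an index into the heap. *)
Definition heap (R U : Type) : Type := seq (seq (val R U)).

(* [eval h env e v h' n]: in heap h and environment env, e evaluates to v, with
   final heap h', in n steps. *)
Inductive eval (R : realType) (U : metricType R) :
    heap R U -> seq (val R U) -> expr -> val R U -> heap R U -> nat -> Prop :=
| EvalVar h env i v :
    onth env i = Some v -> eval h env (EVar i) v h 1
| EvalFun h env e :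
    eval h env (EFun e) (VClos env e) h 1
| EvalApp h env e1 e2 env' b h1 n1 w h2 n2 v h3 n3 :
    eval h env e1 (VClos env' b) h1 n1 ->
    eval h1 env e2 w h2 n2 ->
    eval h2 (w :: VClos env' b :: env') b v h3 n3 ->
    eval h env (EApp e1 e2) v h3 (n1 + n2 + n3).+1
| EvalLet h env e1 e2 w h1 n1 v h2 n2 :
    eval h env e1 w h1 n1 ->
    eval h1 (w :: env) e2 v h2 n2 ->
    eval h env (ELet e1 e2) v h2 (n1 + n2).+1
| EvalIf h env e e1 e2 b h1 n1 v h2 n2 :
    eval h env e (VBool b) h1 n1 ->
    eval h1 env (if b then e1 else e2) v h2 n2 ->
    eval h env (EIf e e1 e2) v h2 (n1 + n2).+1
| EvalInt h env z :
    eval h env (EInt z) (VInt z) h 1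
| EvalReal h env z :
    eval h env (EReal z) (VReal z%:~R) h 1
| EvalPrim h env o e1 e2 v1 h1 n1 v2 h2 n2 v :
    eval h env e1 v1 h1 n1 ->
    eval h1 env e2 v2 h2 n2 ->
    prim_sem o v1 v2 = Some v ->
    eval h env (EPrim o e1 e2) v h2 (n1 + n2).+1
| EvalNil h env :
    eval h env ENil VNil h 1
| EvalPair h env e1 e2 v1 h1 n1 v2 h2 n2 :
    eval h env e1 v1 h1 n1 ->
    eval h1 env e2 v2 h2 n2 ->
    eval h env (EPair e1 e2) (VPair v1 v2) h2 (n1 + n2).+1
| EvalMatchNil h env e e0 e1 h1 n1 v h2 n2 :
    eval h env e VNil h1 n1 ->
    eval h1 env e0 v h2 n2 ->
    eval h env (EMatch e e0 e1) v h2 (n1 + n2).+1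
| EvalMatchPair h env e e0 e1 v1 v2 h1 n1 v h2 n2 :
    eval h env e (VPair v1 v2) h1 n1 ->
    eval h1 (v1 :: v2 :: env) e1 v h2 n2 ->
    eval h env (EMatch e e0 e1) v h2 (n1 + n2).+1
| EvalNew h env e1 e2 s h1 n1 w h2 n2 :
    eval h env e1 (VInt (Posz s)) h1 n1 ->
    eval h1 env e2 w h2 n2 ->
    eval h env (ENew e1 e2) (VArr (size h2)) (rcons h2 (nseq s w))
      (n1 + n2 + s).+1
| EvalGet h env e1 e2 a i h1 n1 h2 n2 v :
    eval h env e1 (VArr a) h1 n1 ->
    eval h1 env e2 (VInt (Posz i)) h2 n2 ->
    onth (nth [::] h2 a) i = Some v ->
    eval h env (EGet e1 e2) v h2 (n1 + n2).+1
| EvalSet h env e1 e2 e3 a i h1 n1 h2 n2 w h3 n3 :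
    eval h env e1 (VArr a) h1 n1 ->
    eval h1 env e2 (VInt (Posz i)) h2 n2 ->
    eval h2 env e3 w h3 n3 ->
    (i < size (nth [::] h3 a))%N ->
    eval h env (ESet e1 e2 e3) VNil
      (set_nth [::] h3 a (set_nth VNil (nth [::] h3 a) i w))
      (n1 + n2 + n3).+1.

(* A program is a closed expression that denotes a function. *)
Definition run (R : realType) (U : metricType R) (prog : expr)
    (input output : val R U) (n : nat) : Prop :=
  exists f h h' n1 n2,
    [/\ eval [::] [::] prog f h n1,
        eval h [:: f; input] (EApp (EVar 0) (EVar 1)) output h' n2
      & n = (n1 + n2)%N].

Definition enc_seq (R U T : Type) (enc : T -> val R U) (s : seq T) : val R U :=
  foldr (fun x v => VPair (enc x) v) VNil s.

Definition enc_points (R U : Type) (s : seq U) : val R U := enc_seq VPoint s.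

Definition enc_augmentation (R U : Type) (a : option (nat * seq U)) :
    val R U :=
  if a is Some (n, B) then VPair (VInt (Posz n)) (enc_points R B) else VNil.

Fixpoint enc_xtree (R U : Type) (t : xtree U) : val R U :=
  let: XNode p l a ts := t in
  VPair (VPoint p)
    (VPair (VInt l) (VPair (enc_augmentation R a)
      (foldr (fun t' v => VPair (enc_xtree R t') v) VNil ts))).

(* [A] solves every instance (P, k) of diversity maximization in U, where P is
   given as a list without repetitions, within factor [a] and in at most
   [time #|P|] steps. *)
Definition approx_algorithm (R : realType) (U : metricType R) (m : measure)
    (A : expr) (a : R) (time : nat -> nat) : Prop :=
  forall (P : seq U) (k : nat), uniq P -> (0 < k <= size P)%N ->
    exists (C : seq U) (n : nat),
      [/\ run A (VPair (enc_points R P) (VInt (Posz k))) (enc_points R C) n,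
          [/\ uniq C, {subset C <= P} & size C = k],
          div_opt m k [fset p in P] / a <= div m [fset p in C]
        & (n <= time (size P))%N].

(* Running time as a function of the input size: it is a worst case over the
   inputs up to the given size, and covers the reading of the input. *)
Definition polynomial_time (time : nat -> nat) : Prop :=
  [/\ {homo time : x y / (x <= y)%N},
      forall n, (n <= time n)%N
    & exists a d : nat, forall n, (time n <= a * n ^ d + a)%N].

(* Main.v *)
Require Import Defs.
From mathcomp Require Import zify lra.

Set Implicit Arguments.
Unset Strict Implicit.
Unset Printing Implicit Defensive.

(** For large [eps] the coreset has to consist of about [k] points, and for
    small [eps] of about [k (64 / eps)^D]; both come from the same search.  Going
    down the cover tree, let [l] be the first level with at least [k] nodes.  Any
    [k] points of that level are [2 ^ l]-separated, so every measure is at least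
    [2 ^ l] times its number of distances (counted with multiplicity), while the
    fewer than [k] nodes of level [l + 1] cover [S] within [2 ^ (l + 2)].  If
    [eps > 8], the points of level [l + 1] are completed to [k] points of level
    [l]; otherwise the search continues to the level [l + 1 - i] with
    [eps * 2 ^ i] in (8, 16], whose size is bounded by packing.  For the measures
    that need an injective proxy of an optimal solution, each node also
    contributes its [k] delegates.  Moving an optimal solution to its proxies
    costs at most [2 * eps] times the optimum of the coreset.

    The time is that of the approximation algorithm on the coreset, plus [k] for
    each level visited before [l] is found.  Once the chain at the root is
    skipped these levels lie between the logarithms of the minimum and of the
    maximum distance.  The later levels grow geometrically, so the last one
    dominates. *)

(** * Stability of the diversity measures *)

(** The size of the coreset is the argument of [tA], and nothing assumed about [tA] lets a constant
    factor move out of its argument. The size bounds are therefore sharp: the last small level has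
    at most [k - 1] nodes, so that with a packing factor [W] the points and the delegates number at
    most [k * W + k * (k - 1) * W = k ^ 2 * W]. For the same reason a large [eps] cannot be served
    by a whole level with at least [k] nodes, whose excess over [k] may depend on [D].

    Nor may the search build the next level just to see whether it has [k] nodes, since that level
    can be much larger than [k]. Only the points that it gains are counted, up to a budget that [k]
    bounds.

    The error is compared with the optimum of the coreset itself, so the [k] separated points have
    to belong to the coreset. One number, [total_weight], multiplies both their separation in the
    lower bound and the displacement of the proxies in the error; it cancels, and one argument
    serves all six measures. With [k = 1] there are no distances to compare, and this case is
    treated apart. *)

Section BigSums.
Context (R : realType) (I : eqType).

Lemma ler_sum_mem (s : seq I) (P : pred I) (F G : I -> R) :
  (forall i, i \in s -> P i -> F i <= G i) ->
  \sum_(i <- s | P i) F i <= \sum_(i <- s | P i) G i.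
Proof.
move=> FG; rewrite big_seq_cond [leRHS]big_seq_cond.
by apply: ler_sum => i /andP[]; exact: FG.
Qed.

Lemma sum_const_count (s : seq I) (P : pred I) (c : R) :
  \sum_(i <- s | P i) c = (count P s)%:R * c.
Proof. by rewrite big_const_seq iter_addr_0 mulr_natl. Qed.

End BigSums.

Section SubsetExtension.
Context (K : choiceType).

Lemma fsubset_extend (A B : {fset K}) (k : nat) :
  A `<=` B -> (#|` A| <= k <= #|` B|)%N ->
  exists Y, [/\ A `<=` Y, Y `<=` B & #|` Y| = k].
Proof.
move=> AB /andP[Ak kB].
have u : uniq (take (k - #|` A|) (B `\` A)) by rewrite take_uniq.
exists (A `|` [fset x in take (k - #|` A|) (B `\` A)]); split.
- exact: fsubsetUl.
- rewrite fsubUset AB /=; apply/fsubsetP => x; rewrite !inE /= => /mem_take.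
  by rewrite inE => /andP[].
- rewrite cardfsU.
  have -> : A `&` [fset x in take (k - #|` A|) (B `\` A)] = fset0.
    apply/fsetP => x; rewrite !inE /=; apply/negP => /andP[xA /mem_take].
    by rewrite inE xA.
  rewrite cardfs0 subn0 card_fseq undup_id // size_take.
  rewrite cardfsDS //; case: ltnP; lia.
Qed.

End SubsetExtension.

(** * Number of edges of a spanning tree *)

Section SpanningTrees.
Context (U : choiceType) (X : {fset U}) (e : rel U).
Hypothesis st : spanning_tree X e.

Lemma path_crossing (s : seq U) a p : path e a p -> a \in s ->
  last a p \notin s -> exists x y, [/\ x \in s, y \notin s & e x y].
Proof.
elim: p a => [|b p IH] a /=; first by move=> _ ->.
case/andP=> ab bp as_ ls; have [bs|bs] := boolP (b \in s).
  exact: IH bp bs ls.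
by exists a, b.
Qed.

(* A vertex adjacent to a connected set of tree vertices has a single neighbour
   there, for two of them would close a cycle; so a tree grown vertex by vertex
   gains one edge at a time. *)
Lemma spanning_tree_grow (n : nat) : (0 < n <= #|` X|)%N ->
  exists s : seq U, [/\ uniq s, {subset s <= X}, size s = n,
    forall x y, x \in s -> y \in s ->
      exists p, [/\ path e x p, last x p = y & {subset p <= s}]
  & (\sum_(p <- s) count (e p) s = 2 * n.-1)%N].
Proof.
have [eX esym econn eacyc] := st.
case: n => // n /=; elim: n => [|n IH] nX.
  have /fset0Pn[x xX] : X != fset0 by rewrite -cardfs_gt0.
  exists [:: x]; split=> //.
  - by move=> y; rewrite inE => /eqP ->.
  - by move=> y z; rewrite !inE => /eqP -> /eqP ->; exists [::].
  - rewrite big_seq1 /= addn0; case: (boolP (e x x)) => // /eX[_ _].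
    by rewrite eqxx.
have [|s [us sX szs sconn sed]] := IH; first by rewrite (leq_trans _ nX).
have [y yX ys] : exists2 y, y \in X & y \notin s.
  apply/exists2P; apply: contrapT => /forallNP H.
  have : X `<=` [fset x in s].
    apply/fsubsetP => y yX; rewrite !inE.
    by apply: contrapT => ys; apply: (H y); split=> //; apply/negP.
  by move/fsubset_leq_card; rewrite card_fseq undup_id // szs leqNgt nX.
have [x xs] : exists x, x \in s.
  by case: (s) szs => // x s' _; exists x; rewrite mem_head.
have [p [xp lp]] := econn x y (sX _ xs) yX.
have [w [v [ws vs wv]]] : exists x y, [/\ x \in s, y \notin s & e x y].
  by apply: (path_crossing xp xs); rewrite lp.
have vw : e v w by rewrite esym.
have nbr z : z \in s -> e v z -> z = w.
  move=> zs vz; apply: contrapT => zw.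
  have [q [wq lq qs]] := sconn w z ws zs.
  move: lq; case: (shortenP wq) => q' wq' uq' q'q lq.
  suff : (size (v :: w :: q') <= 2)%N.
    by case: q' lq {wq' uq' q'q} => //= lq _; rewrite lq in zw.
  apply: eacyc; apply/andP; split; last first.
    rewrite cons_uniq uq' andbT inE negb_or; apply/andP; split.
      by apply: contraNN vs => /eqP ->.
    by apply: contraNN vs => /q'q/qs.
  by rewrite /= vw rcons_path wq' lq esym vz.
exists (v :: s); split.
- by rewrite /= vs us.
- by move=> z; rewrite inE => /predU1P[->|/sX //]; case: (eX _ _ vw).
- by rewrite /= szs.
- move=> a b; rewrite !inE => /predU1P[->|a_s] /predU1P[->|b_s].
  + by exists [::].
  + have [q [wq lq qs]] := sconn w b ws b_s.
    exists (w :: q); split=> //=; first by rewrite vw.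
    move=> z; rewrite !inE => /predU1P[->|/qs ->]; by rewrite ?ws orbT.
  + have [q [wq lq qs]] := sconn a w a_s ws.
    exists (rcons q v); split; rewrite ?last_rcons ?rcons_path ?wq ?lq //.
    by move=> z; rewrite mem_rcons !inE => /predU1P[->|/qs ->];
      rewrite ?eqxx ?orbT.
  + have [q [wq lq qs]] := sconn a b a_s b_s.
    by exists q; split=> // z /qs zs; rewrite inE zs orbT.
- have evv : e v v = false.
    by apply/negP => /eX[_ _]; rewrite eqxx.
  have c1 : count (e v) s = 1%N.
    have -> : count (e v) s = count_mem w s.
      by apply: eq_in_count => z zs /=; apply/idP/eqP => [|->//]; exact: nbr.
    by rewrite count_uniq_mem // ws.
  rewrite big_cons /= evv add0n c1 big_split /= sed.
  have -> : (\sum_(i <- s) e i v)%N = count (e v) s.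
    by rewrite -sum1_count [RHS]big_mkcond /=; apply: eq_bigr => i _; rewrite esym;
      case: (e v i).
  rewrite c1; lia.
Qed.

(** A subtree grown to the size of [X] exhausts [X]. Each edge is counted from both of its ends. *)
Lemma spanning_tree_edges : X != fset0 ->
  (\sum_(p <- X) count (e p) X = 2 * #|` X|.-1)%N.
Proof.
rewrite -cardfs_gt0 => X0.
have [|s [us sX szs _ <-]] := @spanning_tree_grow #|` X|; first by rewrite X0 /=.
have pe : perm_eq X s.
  rewrite perm_sym; apply: uniq_perm => //.
  by have [|_] := uniq_min_size us sX; rewrite ?szs.
rewrite (perm_big _ pe) /=; apply: eq_bigr => p _; exact/permP.
Qed.

End SpanningTrees.

(** A witness that spanning trees exist: the infimum in [remote_tree] is then over a nonempty set
    and can be bounded from below. *)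
Lemma star_spanning_tree (U : choiceType) (X : {fset U}) (c : U) : c \in X ->
  spanning_tree X
    (fun p q => [&& p \in X, q \in X, p != q & (p == c) || (q == c)]).
Proof.
move=> cX; split.
- by move=> p q /and4P[].
- by move=> p q /=; rewrite andbCA eq_sym orbC.
- move=> p q pX qX; have [->|pq] := eqVneq p q; first by exists [::].
  have [pc|pc] := eqVneq p c.
    by exists [:: q] => /=; rewrite pX qX pq pc eqxx.
  have [qc|qc] := eqVneq q c.
    by exists [:: q] => /=; rewrite pX qX pq qc eqxx orbT.
  exists [:: c; q] => /=.
  by rewrite pX qX pc cX eqxx orbT /= eq_sym qc.
- case=> [|x [|y [|z s]]] // /andP[] /=.
  case/and3P=> /and4P[_ _ _ xy] /and4P[_ _ _ yz] zs.
  rewrite !inE !negb_or => /and4P[/and3P[nxy nxz nxs] /andP[nyz nys] nzs us].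
  (* Consecutive edges of the cycle both touch the centre and [x] differs from [z], so their common
     vertex [y] is the centre. The edge that leaves [z] then misses it. *)
  have yc : y == c.
    case/orP: xy => // /eqP xc; case/orP: yz => // /eqP zc.
    by rewrite xc zc eqxx in nxz.
  move: zs; rewrite -(eqP yc).
  case: s nxs nys nzs us => [|w s] /=.
    by move=> _ _ _ _; rewrite (eq_sym z y) (negbTE nyz) (negbTE nxy) !andbF.
  rewrite !inE !negb_or => /andP[xw _] /andP[yw _] /andP[zw _] _.
  by rewrite (eq_sym w y) (negbTE yw) (eq_sym z y) (negbTE nyz) !andbF.
Qed.

(** The number of distances that the measure adds up on [k] points; for remote-clique these are
    ordered pairs, as in its definition. *)
Definition total_weight (m : measure) (k : nat) : nat :=
  match m with
  | RemoteEdge => 1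
  | RemoteClique => k * k.-1
  | RemoteStar | RemoteTree => k.-1
  | RemoteBipartition => k./2 * (k - k./2)
  | RemoteCycle => k
  end.

(** * Bounds on each measure, and its value on separated sets *)

Section Measures.
Context (R : realType) (U : metricType R).
Implicit Types (X Y S P : {fset U}) (p q : U) (sigma delta : R).

Lemma mdist_le_moved p p' q q' delta :
  mdist p p' <= delta -> mdist q q' <= delta ->
  mdist p q <= mdist p' q' + 2 * delta.
Proof.
move=> pp' qq'; have := metric_triangle p p' q; have := metric_triangle p' q' q.
by rewrite (metric_sym q' q); lra.
Qed.

Lemma remote_edge_le X p q : p \in X -> q \in X -> p != q ->
  remote_edge X <= mdist p q.
Proof.
move=> pX qX pq; apply: ge_inf; last by exists p, q.
by exists 0 => _ [a [b [_ _ _ ->]]]; exact: mdist_ge0.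
Qed.

Lemma remote_star_le X c : c \in X ->
  remote_star X <= \sum_(q <- X `\ c) mdist c q.
Proof.
move=> cX; apply: ge_inf; last by exists c.
by exists 0 => _ [a _ <-]; apply: sumr_ge0 => *; exact: mdist_ge0.
Qed.

Lemma remote_bipartition_le X Q : Q `<=` X -> #|` Q| = #|` X|./2 ->
  remote_bipartition X <= \sum_(q <- Q) \sum_(z <- X `\` Q) mdist q z.
Proof.
move=> QX cQ; apply: ge_inf; last by exists Q.
by exists 0 => _ [a _ <-]; do 2![apply: sumr_ge0 => * //]; exact: mdist_ge0.
Qed.

Lemma remote_tree_le X e : spanning_tree X e ->
  remote_tree X <= tree_weight X e.
Proof.
move=> st; apply: ge_inf; last by exists e.
exists 0 => _ [a _ <-]; apply: divr_ge0 => //.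
by do 2![apply: sumr_ge0 => * //]; exact: mdist_ge0.
Qed.

Lemma remote_cycle_le X (s : seq U) : uniq s -> s =i X ->
  remote_cycle X <= \sum_(p <- s) mdist p (next s p).
Proof.
move=> us sX; apply: ge_inf; last by exists s.
by exists 0 => _ [a _ <-]; apply: sumr_ge0 => *; exact: mdist_ge0.
Qed.

Lemma le_remote_edge X b : (1 < #|` X|)%N ->
  (forall p q, p \in X -> q \in X -> p != q -> b <= mdist p q) ->
  b <= remote_edge X.
Proof.
move=> X1 H; apply: lb_le_inf; last first.
  by move=> _ [p [q [pX qX pq ->]]]; exact: H.
have /fset0Pn[p pX] : X != fset0 by rewrite -cardfs_gt0 (ltn_trans _ X1).
have /fset0Pn[q] : X `\ p != fset0.
  by move: X1; rewrite -cardfs_gt0 (cardfsD1 p) pX.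
rewrite !inE => /andP[qp qX]; exists (mdist p q), p, q; split=> //.
by rewrite eq_sym.
Qed.

Lemma le_remote_star X b : X != fset0 ->
  (forall c, c \in X -> b <= \sum_(q <- X `\ c) mdist c q) ->
  b <= remote_star X.
Proof.
move=> /fset0Pn[c cX] H; apply: lb_le_inf; last by move=> _ [d dX <-]; exact: H.
by exists (\sum_(q <- X `\ c) mdist c q), c.
Qed.

Lemma le_remote_bipartition X b :
  (forall Q, Q `<=` X -> #|` Q| = #|` X|./2 ->
    b <= \sum_(q <- Q) \sum_(z <- X `\` Q) mdist q z) ->
  b <= remote_bipartition X.
Proof.
move=> H; apply: lb_le_inf; last by move=> _ [Q [QX cQ] <-]; exact: H.
have [|Q [_ QX cQ]] := @fsubset_extend _ fset0 X #|` X|./2 (fsub0set _).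
  by rewrite cardfs0 /=; lia.
by exists (\sum_(q <- Q) \sum_(z <- X `\` Q) mdist q z), Q.
Qed.

Lemma le_remote_tree X b : X != fset0 ->
  (forall e, spanning_tree X e -> b <= tree_weight X e) ->
  b <= remote_tree X.
Proof.
move=> /fset0Pn[c cX] H; apply: lb_le_inf; last by move=> _ [e st <-]; exact: H.
by eexists; eexists; first exact: star_spanning_tree cX.
Qed.

Lemma le_remote_cycle X b :
  (forall s : seq U, uniq s -> s =i X ->
    b <= \sum_(p <- s) mdist p (next s p)) ->
  b <= remote_cycle X.
Proof.
move=> H; apply: lb_le_inf; last by move=> _ [s [us sX] <-]; exact: H.
by eexists; exists (enum_fset X); first by split; first exact: fset_uniq.
Qed.

Lemma sum_others X p (F : U -> R) :
  \sum_(q <- X | q != p) F q = \sum_(q <- X `\ p) F q.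
Proof.
rewrite -big_filter; apply: perm_big; apply: uniq_perm => //.
  exact: filter_uniq.
by move=> q; rewrite mem_filter !inE.
Qed.

Lemma remote_cliqueE X :
  remote_clique X = \sum_(p <- X) \sum_(q <- X | q != p) mdist p q.
Proof.
rewrite /remote_clique; apply: eq_bigr => p _.
rewrite (bigID (fun q => q == p)) /= big1 ?add0r // => q /eqP ->.
exact: mdistxx.
Qed.

Lemma count_others X p : p \in X -> count (fun q => q != p) X = #|` X|.-1.
Proof.
move=> pX; have := count_predC (pred1 p) X.
rewrite count_uniq_mem ?fset_uniq // [p \in _]pX => /(congr1 predn) /= <-.
exact: eq_count.
Qed.

Lemma next_neq (s : seq U) p : uniq s -> (1 < size s)%N -> p \in s ->
  next s p != p.
Proof.
case: s => // x s us sz ps; rewrite next_nth ps.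
have hp : (index p (x :: s) < size (x :: s))%N by rewrite index_mem.
have [lt|ge] := ltnP (index p (x :: s)) (size s).
  rewrite -{2}(nth_index x ps) -[nth x s _]/(nth x (x :: s) _.+1).
  by rewrite nth_uniq //= -?ltnS //; lia.
rewrite nth_default //; apply/eqP => xp; move: ge; rewrite -xp /= eqxx.
by case: (s) sz.
Qed.

(** Also applied with [sigma = 0], to show that the measures are nonnegative. *)
Lemma le_div_separated m X k sigma : #|` X| = k -> (1 < k)%N ->
  (forall p q, p \in X -> q \in X -> p != q -> sigma <= mdist p q) ->
  (total_weight m k)%:R * sigma <= div m X.
Proof.
move=> cX k1 sep; have X0 : X != fset0 by rewrite -cardfs_gt0 cX; lia.
case: m => /=.
- by rewrite mul1r; apply: le_remote_edge => //; rewrite cX.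
- rewrite remote_cliqueE.
  apply: le_trans (ler_sum_mem (F := fun=> k.-1%:R * sigma) _).
    by rewrite sum_const_count count_predT [size _]cX natrM mulrA.
  move=> p pX _.
  apply: le_trans (ler_sum_mem (F := fun=> sigma) _).
    by rewrite sum_const_count count_others // cX.
  by move=> q qX qp; apply: sep => //; rewrite eq_sym.
- apply: le_remote_star => // c cX'.
  apply: le_trans (ler_sum_mem (F := fun=> sigma) _).
    rewrite sum_const_count count_predT [size _](_ : _ = k.-1) //.
    by have := cardfsD1 c X; rewrite cX cX' => ->.
  by move=> q; rewrite !inE => /andP[qc qX] _; apply: sep => //; rewrite eq_sym.
- apply: le_remote_bipartition => Q QX cQ.
  apply: le_trans (ler_sum_mem (F := fun=> (k - k./2)%:R * sigma) _).
    by rewrite sum_const_count count_predT [size _]cQ cX natrM mulrA.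
  move=> p pQ _.
  apply: le_trans (ler_sum_mem (F := fun=> sigma) _).
    rewrite sum_const_count count_predT [size _](_ : _ = (k - k./2)%N) //.
    by rewrite -cX -cQ -cardfsDS.
  move=> q; rewrite !inE => /andP[qQ qX] _; apply: sep => //.
    exact: (fsubsetP QX).
  by apply: contraNN qQ => /eqP <-.
- apply: le_remote_tree => // e st; rewrite ler_pdivlMr //.
  have [eX _ _ _] := st.
  apply: le_trans (ler_sum_mem (F := fun p => (count (e p) X)%:R * sigma) _).
    rewrite -mulr_suml -natr_sum spanning_tree_edges // cX natrM; lra.
  move=> p pX _; rewrite -sum_const_count; apply: ler_sum_mem => q qX /eX[].
  by move=> _ _; exact: sep.
- apply: le_remote_cycle => s us sX.
  have szs : size s = k.
    by rewrite -cX; apply/perm_size/uniq_perm => //; exact: fset_uniq.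
  rewrite -szs -(count_predT s) -sum_const_count.
  apply: ler_sum_mem => p ps _; apply: sep; rewrite -?sX ?mem_next //.
  by rewrite eq_sym next_neq // szs.
Qed.

End Measures.

(** An injective [phi] is an isomorphism of complete graphs onto the image, so that a tree on the
    moved points can be compared edge by edge with one on [X]. *)
Lemma spanning_tree_pullback (U : choiceType) (X : {fset U}) (phi : U -> U)
    (e : rel U) : {in X &, injective phi} ->
  spanning_tree [fset phi x | x in X] e ->
  spanning_tree X (fun p q => [&& p \in X, q \in X & e (phi p) (phi q)]).
Proof.
move=> inj [eX esym econn eacyc]; split.
- move=> p q /and3P[pX qX /eX[_ _ pq]]; split=> //.
  by apply: contraNN pq => /eqP ->.
- by move=> p q /=; rewrite andbCA esym.
- move=> p q pX qX.
  have [||s [+ +]] := econn (phi p) (phi q); try exact: in_imfset.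
  elim: s p pX => [|y s IH] p pX /=.
    by move=> _ pq; exists [::]; split=> //=; exact: inj.
  case/andP=> py ys ls; have [_ /imfsetP[/= z zX yz] _] := eX _ _ py.
  rewrite {}yz in py ys ls; have [t [zt lt]] := IH z zX ys ls.
  by exists (z :: t); rewrite /= zt pX zX py.
- move=> s /andP[cs us].
  (* [phi] is injective on [X] only, so the vertices of the cycle have to be located in [X] before
     they are mapped. *)
  have sX : {subset s <= X}.
    case: s cs {us} => // x s /= xs y ys.
    have {ys} : y \in rcons s x by rewrite mem_rcons.
    move: (rcons s x) xs => l; elim: l x => [|a l IH] b //=.
    case/andP=> /and3P[_ aX _] al; rewrite inE => /predU1P[->//|].
    exact: IH al.
  rewrite -(size_map phi); apply: eacyc; apply/andP; split.
    case: s cs {us sX} => //= x s; rewrite -map_rcons path_map.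
    by apply: sub_path => a b /and3P[].
  by rewrite map_inj_in_uniq // => a b /sX aX /sX bX; exact: inj.
Qed.

(** * Effect of replacing points by nearby ones *)

Section Stability.
Context (R : realType) (U : metricType R).
Implicit Types (X Y S P : {fset U}) (p q : U) (sigma delta : R).

Lemma sum_image (phi : U -> U) X (F : U -> R) : {in X &, injective phi} ->
  \sum_(q <- [fset phi x | x in X]) F q = \sum_(q <- X) F (phi q).
Proof. by move=> inj; rewrite big_imfset. Qed.

Lemma card_image (phi : U -> U) X : {in X &, injective phi} ->
  #|` [fset phi x | x in X]| = #|` X|.
Proof. by move=> inj; rewrite card_in_imfset. Qed.

(** Every centre, bipartition or tree on the image pulls back through the injective [phi] to one on
    [X] with the same number of distances, each longer by at most [2 * delta]. *)
Lemma div_moved_le m X k (phi : U -> U) delta : uses_augmentation m ->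
  #|` X| = k -> (0 < k)%N -> {in X &, injective phi} ->
  (forall x, x \in X -> mdist x (phi x) <= delta) ->
  div m X <= div m [fset phi x | x in X] + (total_weight m k)%:R * (2 * delta).
Proof.
move=> mA cX k0 inj mv; have X0 : X != fset0 by rewrite -cardfs_gt0 cX.
have inj' Z : Z `<=` X -> {in Z &, injective phi}.
  by move=> /fsubsetP ZX a b /ZX aX /ZX bX; exact: inj.
have fX0 : [fset phi x | x in X] != fset0.
  by case/fset0Pn: X0 => x xX; apply/fset0Pn; exists (phi x); exact: in_imfset.
have mvd p q : p \in X -> q \in X ->
    mdist p q <= mdist (phi p) (phi q) + 2 * delta.
  by move=> pX qX; apply: mdist_le_moved; exact: mv.
case: m mA => //= _.
- rewrite !remote_cliqueE sum_image //.
  apply: (@le_trans _ _ (\sum_(p <- X)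
      (\sum_(q <- X | q != p) mdist (phi p) (phi q) + k.-1%:R * (2 * delta)))).
    apply: ler_sum_mem => p pX _.
    rewrite -cX -(count_others pX) -sum_const_count -big_split /=.
    by apply: ler_sum_mem => q qX _; exact: mvd.
  rewrite big_split /= sum_const_count count_predT [size _]cX natrM mulrA lerD2r.
  apply: ler_sum_mem => p pX _; rewrite !sum_others.
  have -> : [fset phi x | x in X] `\ phi p = [fset phi x | x in X `\ p].
    apply/fsetP => y; rewrite !inE; apply/andP/imfsetP => /= [[yp]|].
      case/imfsetP => x /= xX yx; exists x => //; rewrite !inE xX andbT.
      by apply: contraNN yp => /eqP <-; rewrite yx.
    case=> x; rewrite !inE => /andP[xp xX] ->; split; last exact: in_imfset.
    by apply: contraNN xp => /eqP/inj ->.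
  by rewrite (sum_image _ (inj' _ (fsubD1set _ _))).
- rewrite -lerBlDr; apply: le_remote_star => // c' /imfsetP[/= c cX' ->].
  rewrite lerBlDr; apply: le_trans (remote_star_le cX') _.
  have -> : [fset phi x | x in X] `\ phi c = [fset phi x | x in X `\ c].
    apply/fsetP => y; rewrite !inE; apply/andP/imfsetP => /= [[yp]|].
      case/imfsetP => x /= xX yx; exists x => //; rewrite !inE xX andbT.
      by apply: contraNN yp => /eqP <-; rewrite yx.
    case=> x; rewrite !inE => /andP[xp xX] ->; split; last exact: in_imfset.
    by apply: contraNN xp => /eqP/inj ->.
  rewrite (sum_image _ (inj' _ (fsubD1set _ _))).
  have -> : k.-1 = count predT (X `\ c).
    by rewrite count_predT; have := cardfsD1 c X; rewrite cX cX' => ->.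
  rewrite -sum_const_count -big_split /=.
  by apply: ler_sum_mem => q; rewrite !inE => /andP[_ qX] _; exact: mvd.
- rewrite -lerBlDr; apply: le_remote_bipartition => Q' Q'X cQ'.
  rewrite lerBlDr; pose Q := [fset x in X | phi x \in Q'].
  have QX : Q `<=` X by apply/fsubsetP => x; rewrite !inE => /andP[].
  have Q'E : Q' = [fset phi x | x in Q].
    apply/fsetP => y; apply/idP/imfsetP => /= [yQ'|[x]].
      have /imfsetP[/= x xX yx] := fsubsetP Q'X _ yQ'.
      by exists x => //; rewrite !inE xX -yx.
    by rewrite !inE => /andP[xX xQ] ->.
  have DE : [fset phi x | x in X] `\` Q' = [fset phi x | x in X `\` Q].
    apply/fsetP => y; rewrite !inE; apply/andP/imfsetP => /= [[yQ']|[x]].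
      case/imfsetP => x /= xX yx; exists x => //.
      by rewrite !inE xX -yx (negbTE yQ').
    by rewrite !inE => /andP[+ xX] ->; rewrite xX /=; split=> //; exact: in_imfset.
  have cQ : #|` Q| = k./2.
    have cfX : #|` [fset phi x | x in X]| = k by rewrite card_image.
    by rewrite -cfX -cQ' Q'E (card_image (inj' _ QX)).
  apply: le_trans (remote_bipartition_le QX _) _; first by rewrite cX.
  rewrite DE Q'E (sum_image _ (inj' _ QX)).
  apply: (@le_trans _ _ (\sum_(p <- Q) (\sum_(q <- X `\` Q)
      mdist (phi p) (phi q) + (k - k./2)%:R * (2 * delta)))).
    apply: ler_sum_mem => p pQ _.
    have -> : (k - k./2)%N = count predT (X `\` Q).
      by rewrite count_predT [RHS](cardfsDS QX) cQ cX.
    rewrite -sum_const_count -big_split /=.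
    apply: ler_sum_mem => q; rewrite !inE => /andP[_ qX] _; apply: mvd => //.
    exact: (fsubsetP QX).
  rewrite big_split /= sum_const_count count_predT [size _]cQ natrM mulrA lerD2r.
  apply: ler_sum_mem => p pX _; rewrite (sum_image _ (inj' _ (fsubsetDl _ _))).
  exact: lexx.
- rewrite -lerBlDr; apply: le_remote_tree => // e st.
  have st' := spanning_tree_pullback inj st.
  rewrite lerBlDr; apply: le_trans (remote_tree_le st') _.
  rewrite /tree_weight sum_image // ler_pdivrMr // mulrDl divfK ?pnatr_eq0 //.
  set e' := fun p q => _ in st' *.
  apply: (@le_trans _ _ (\sum_(p <- X) (\sum_(q <- X | e' p q)
      mdist (phi p) (phi q) + (count (e' p) X)%:R * (2 * delta)))).
    apply: ler_sum_mem => p pX _.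
    rewrite -sum_const_count -big_split /=.
    by apply: ler_sum_mem => q qX _; exact: mvd.
  rewrite big_split /= -mulr_suml -natr_sum spanning_tree_edges // cX.
  apply: lerD; last by rewrite natrM; lra.
  apply: ler_sum_mem => p pX _.
  rewrite [leRHS]big_mkcond sum_image //= -big_mkcond /=.
  rewrite le_eqVlt; apply/orP; left; apply/eqP.
  by rewrite big_seq_cond [RHS]big_seq_cond; apply: eq_bigl => q;
    rewrite /e' pX; case: (q \in X).
Qed.

(** No injectivity is required: if two points of [X] share a proxy, they are within [2 * delta] of
    each other, and any [k] points of [P] will do. *)
Lemma remote_edge_cover_le X P k (pi : U -> U) delta :
  #|` X| = k -> (1 < k <= #|` P|)%N -> 0 <= delta ->
  (forall x, x \in X -> pi x \in P /\ mdist x (pi x) <= delta) ->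
  exists Y, [/\ Y `<=` P, #|` Y| = k
    & remote_edge X <= remote_edge Y + 2 * delta].
Proof.
move=> cX /andP[k1 kP] d0 H.
have [inj|ninj] := pselect {in X &, injective pi}.
  exists [fset pi x | x in X]; split.
  - by apply/fsubsetP => _ /imfsetP[x /= /H[? _] ->].
  - by rewrite card_image.
  rewrite -lerBlDr; apply: le_remote_edge; first by rewrite card_image // cX.
  move=> _ _ /imfsetP[p /= pX ->] /imfsetP[q /= qX ->] pq.
  rewrite lerBlDr; apply: le_trans (remote_edge_le pX qX _) _.
    by apply: contraNN pq => /eqP ->.
  by apply: mdist_le_moved; [case: (H p)|case: (H q)].
have [p [q [pX qX pq npq]]] : exists p q,
    [/\ p \in X, q \in X, pi p = pi q & p != q].
  apply: contrapT => N; apply: ninj => p q pX qX pq; apply: contrapT => npq.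
  by apply: N; exists p, q; split=> //; apply/eqP.
have [|Y [_ YP cY]] := @fsubset_extend _ fset0 P k (fsub0set _).
  by rewrite cardfs0.
exists Y; split=> //; apply: le_trans (remote_edge_le pX qX npq) _.
have Y0 : 0 <= remote_edge Y.
  by apply: le_remote_edge => [|*]; [rewrite cY|exact: mdist_ge0].
have := metric_triangle p (pi p) q; have [_ dp] := H p pX.
by have [_] := H q qX; rewrite -pq (metric_sym q (pi p)); lra.
Qed.

(** A tour [x :: s] is cut open into the walk from [x] along [rcons s x], a form suited to
    induction, which the cyclic [next] is not. *)
Fixpoint walk_length (x : U) (s : seq U) : R :=
  if s is y :: s' then mdist x y + walk_length y s' else 0.

Lemma walk_lengthE x s : walk_length x s =
  \sum_(0 <= i < size s) mdist (nth x (x :: s) i) (nth x s i).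
Proof.
elim: s x => [|y s IH] x; first by rewrite big_nil.
rewrite big_nat_recl //= IH; congr (_ + _).
apply: eq_big_nat => i /andP[_ si].
by rewrite (set_nth_default x) //= ?(set_nth_default x) // ltnS ltnW.
Qed.

Lemma tour_lengthE x s : uniq (x :: s) ->
  \sum_(p <- x :: s) mdist p (next (x :: s) p) = walk_length x (rcons s x).
Proof.
move=> us; rewrite walk_lengthE size_rcons (big_nth x).
apply: eq_big_nat => i /andP[_ si].
rewrite next_nth mem_nth // index_uniq //.
rewrite -rcons_cons !nth_rcons /= si; congr mdist.
by case: ltnP => // ge; rewrite nth_default // if_same.
Qed.

(** Each point of [l] is charged a trip from [y] and a trip back, of length at most [delta] each. *)
Lemma walk_length_insert x y l r delta : r != [::] ->
  (forall b, b \in l -> mdist b y <= delta) ->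
  walk_length x (l ++ r) <=
    mdist x y + 2 * delta * (size l)%:R + walk_length y r.
Proof.
move=> r0; elim: l x => [|b l IH] x H /=.
  rewrite mulr0 addr0; case: r r0 => // c r _ /=.
  by have := metric_triangle x y c; lra.
have Hb : mdist b y <= delta by apply: H; rewrite mem_head.
have /(IH b) : forall b, b \in l -> mdist b y <= delta.
  by move=> c cl; apply: H; rewrite inE cl orbT.
have := metric_triangle x y b; rewrite (metric_sym y b) -natr1; lra.
Qed.

Lemma walk_length_fibers (fib : U -> seq U) x z ys delta :
  (forall y b, y \in ys -> b \in fib y -> mdist b y <= delta) ->
  walk_length x (rcons (flatten (map fib ys)) z) <=
    walk_length x (rcons ys z)
    + 2 * delta * (size (flatten (map fib ys)))%:R.
Proof.
elim: ys x => [|y ys IH] x H /=; first by lra.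
rewrite rcons_cat.
apply: le_trans (walk_length_insert (y := y) (delta := delta) _ _ _) _.
- by case: flatten.
- by move=> b; apply: H; rewrite mem_head.
have /(IH y) : forall y b, y \in ys -> b \in fib y -> mdist b y <= delta.
  by move=> c b cy; apply: H; rewrite inE cy orbT.
by rewrite size_cat natrD; lra.
Qed.

(* Replacing every point of a tour of Y by the points of X that are projected to
   it gives a tour of X. *)
Lemma remote_cycle_cover_le X Y k (pi : U -> U) delta :
  #|` X| = k -> (0 < k)%N ->
  (forall x, x \in X -> pi x \in Y /\ mdist x (pi x) <= delta) ->
  remote_cycle X <= remote_cycle Y + 2 * delta * k%:R.
Proof.
move=> cX k0 H; rewrite -lerBlDr; apply: le_remote_cycle => s us sY.
rewrite lerBlDr; pose fib y := [seq x <- X | pi x == y].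
pose t := flatten (map fib s).
have tX : t =i X.
  move=> x; apply/flattenP/idP => [[_ /mapP[y _ ->]]|xX].
    by rewrite mem_filter => /andP[].
  exists (fib (pi x)); last by rewrite mem_filter eqxx.
  by apply: map_f; rewrite sY; case: (H x xX).
have ut : uniq t.
  rewrite /t; move: us; elim: (s) => //= y l IH /andP[yl /IH ul].
  rewrite cat_uniq filter_uniq ?fset_uniq // ul andbT /=.
  apply/hasPn => x /flattenP[_ /mapP[z zl ->]]; rewrite !mem_filter.
  case/andP=> /eqP xz _; rewrite xz; apply/negP => /andP[/eqP zy _].
  by rewrite -zy zl in yl.
have szt : size t = k.
  by rewrite -cX; apply/perm_size/uniq_perm => //; exact: fset_uniq.
apply: le_trans (remote_cycle_le ut tX) _.
have Et : t = flatten (map fib s) by []; clearbody t.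
case: s us sY Et => [|y s] us sY Et; first by rewrite -szt Et in k0.
have fibP z b : z \in y :: s -> b \in fib z -> mdist b z <= delta.
  by move=> _; rewrite mem_filter => /andP[/eqP <- /H[]].
have := walk_length_fibers y y fibP.
rewrite -Et szt; case: t szt ut {tX Et} => [|x r] szt ut; first by rewrite -szt in k0.
rewrite !tour_lengthE //= mdistxx add0r.
(* The walk through the fibres starts and ends at [y], the tour of [X] at its first point [x]: the
   initial step from [y] to [x] pays for the final one. *)
have last_le a l : walk_length a (rcons l x) <= walk_length a (rcons l y) + mdist y x.
  elim: l a => [|b l IH] a /=; first by rewrite !addr0; exact: metric_triangle.
  by rewrite -addrA lerD2l.
by have := last_le x r; lra.
Qed.

(** For remote-cycle the image of [X] may have fewer than [k] points and is padded within [P]. A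
    padding point has an empty fibre and is bypassed by the triangle inequality. *)
Lemma remote_cover_le m X P k (pi : U -> U) delta : ~~ uses_augmentation m ->
  #|` X| = k -> (1 < k <= #|` P|)%N -> 0 <= delta ->
  (forall x, x \in X -> pi x \in P /\ mdist x (pi x) <= delta) ->
  exists Y, [/\ Y `<=` P, #|` Y| = k
    & div m X <= div m Y + (total_weight m k)%:R * (2 * delta)].
Proof.
move=> + cX /andP[k1 kP] d0 H; case: m => //= _.
  rewrite mul1r; apply: remote_edge_cover_le => //; first by rewrite k1.
  exact: H.
have [||Y [piY YP cY]] := @fsubset_extend _ [fset pi x | x in X] P k.
- by apply/fsubsetP => _ /imfsetP[x /= /H[? _] ->].
- by rewrite kP andbT -cX; exact: leq_imfset_card.
exists Y; split=> //; rewrite mulrC; apply: (remote_cycle_cover_le (pi := pi)) => //.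
  by rewrite (ltn_trans _ k1).
move=> x xX; split; last by case: (H x xX).
by apply: (fsubsetP piY); exact: in_imfset.
Qed.

Lemma div_le_opt m k S C : C `<=` S -> #|` C| = k -> div m C <= div_opt m k S.
Proof.
move=> CS cC; apply: ub_le_sup; last by exists C.
(* Any upper bound will do; there are finitely many candidates, so the sum of the absolute values
   over all subsets is one. *)
exists (\sum_(X <- fpowerset S) `|div m X|) => _ [X [XS _] <-].
rewrite (big_fsetD1 X) ?fpowersetE //=.
apply: le_trans (ler_norm _) _; rewrite lerDl; exact: sumr_ge0.
Qed.

Lemma div_opt_le m k S b : (k <= #|` S|)%N ->
  (forall C, C `<=` S -> #|` C| = k -> div m C <= b) -> div_opt m k S <= b.
Proof.
move=> kS H; apply: ge_sup; last by move=> _ [C [CS cC] <-]; exact: H.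
have [|C [_ CS cC]] := @fsubset_extend _ fset0 S k (fsub0set _).
  by rewrite cardfs0.
by exists (div m C), C.
Qed.

(** Settles the quality of the answer for [k = 1]. *)
Lemma div_singleton m p : div m [fset p] = 0.
Proof.
have c1 := cardfs1 p.
case: m => /=.
- rewrite /remote_edge (_ : distances _ = set0) ?inf0 //.
  apply/seteqP; split=> // d [a [b [+ + ab _]]].
  by rewrite !inE => /eqP aE /eqP bE; rewrite aE bE eqxx in ab.
- by rewrite /remote_clique !big_seq_fset1 mdistxx.
- apply/eqP; rewrite eq_le; apply/andP; split.
    apply: le_trans (remote_star_le (c := p) _) _; first by rewrite inE.
    by rewrite (_ : _ `\ _ = fset0) ?big_seq_fset0 //; apply/fsetP => x;
      rewrite !inE andNb.
  apply: le_remote_star; first by rewrite -cardfs_gt0 c1.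
  by move=> *; apply: sumr_ge0 => *; exact: mdist_ge0.
- apply/eqP; rewrite eq_le; apply/andP; split.
    apply: le_trans (remote_bipartition_le (Q := fset0) (fsub0set _) _) _.
      by rewrite cardfs0 c1.
    by rewrite big_seq_fset0.
  by apply: le_remote_bipartition => *; do 2![apply: sumr_ge0 => * //];
    exact: mdist_ge0.
- apply/eqP; rewrite eq_le; apply/andP; split.
    have st : spanning_tree [fset p] (fun=> xpred0 : pred U).
      split=> //; first by move=> a b; rewrite !inE => /eqP -> /eqP ->; exists [::].
      by case=> // a [|b l].
    apply: le_trans (remote_tree_le st) _.
    by rewrite /tree_weight big1 ?mul0r // => *; rewrite big_pred0.
  apply: le_remote_tree; first by rewrite -cardfs_gt0 c1.
  move=> e _; apply: divr_ge0 => //.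
  by do 2![apply: sumr_ge0 => * //]; exact: mdist_ge0.
- apply/eqP; rewrite eq_le; apply/andP; split.
    apply: le_trans (remote_cycle_le (s := [:: p]) _ _) _ => //.
      by move=> x; rewrite !inE.
    by rewrite big_seq1 /= eqxx mdistxx.
  by apply: le_remote_cycle => *; apply: sumr_ge0 => *; exact: mdist_ge0.
Qed.

End Stability.

(** * Packing and cover trees *)

Section Packing.
Context (R : realType).

Lemma pow2_gt0 (l : int) : 0 < (2 : R) ^ l.
Proof. exact: exprz_gt0. Qed.

Lemma pow2S (l : int) : (2 : R) ^ (l + 1) = 2 * 2 ^ l.
Proof. by rewrite expfzDr ?pnatr_eq0 // expr1z mulrC. Qed.

Lemma pow2D (l : int) (n : nat) : (2 : R) ^ (l + n%:Z) = 2 ^ l * 2 ^+ n.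
Proof. by rewrite expfzDr ?pnatr_eq0. Qed.

Lemma ler_pow2 (l l' : int) : l <= l' -> (2 : R) ^ l <= 2 ^ l'.
Proof. by move=> ll'; apply: ler_weXz2l => //; rewrite ler1n. Qed.

Context (U : metricType R).

Definition halving (N : nat) : Prop :=
  forall (p : U) (r : R), exists cs : seq U, (size cs <= N)%N /\
    forall q, mdist p q <= r -> exists2 c, c \in cs & mdist c q <= r / 2.

Lemma halving_iter N m (p : U) (r : R) : halving N ->
  exists cs : seq U, (size cs <= N ^ m)%N /\
    forall q, mdist p q <= r -> exists2 c, c \in cs & mdist c q <= r / 2 ^+ m.
Proof.
move=> hN; elim: m => [|m [cs [szcs csP]]].
  by exists [:: p]; split=> // q pq; exists p; rewrite ?mem_head // expr0 divr1.
have /choice[f fP] : forall c, exists ds : seq U, (size ds <= N)%N /\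
    forall q, mdist c q <= r / 2 ^+ m ->
      exists2 d, d \in ds & mdist d q <= r / 2 ^+ m.+1.
  move=> c; have [ds [szds dsP]] := hN c (r / 2 ^+ m); exists ds; split=> // q.
  by move=> /dsP[d dds dq]; exists d; rewrite // exprS invfM mulrCA mulrC.
exists (flatten (map f cs)); split.
  rewrite expnS; apply: (@leq_trans (size cs * N)); last first.
    by rewrite mulnC leq_mul2l szcs orbT.
  elim: cs {szcs csP} => //= c cs IH; rewrite size_cat mulSn leq_add //.
  by case: (fP c).
move=> q /csP[c ccs /(proj2 (fP c))[d dc dq]]; exists d => //.
by apply/flattenP; exists (f c) => //; exact: map_f.
Qed.

(** Halving [m] times covers each ball around [C] by [N ^ m] balls of radius [r / 2 ^+ m]. The
    points of [A] are farther apart than the diameter of such a ball, so each ball holds at most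
    one. *)
Lemma packing N m (C A : {fset U}) (r : R) : halving N ->
  (forall a, a \in A -> exists2 c, c \in C & mdist c a <= r) ->
  (forall a b, a \in A -> b \in A -> a != b -> 2 * (r / 2 ^+ m) < mdist a b) ->
  (#|` A| <= #|` C| * N ^ m)%N.
Proof.
move=> hN AC sep.
have /choice[f fP] := fun p => @halving_iter N m p r hN.
pose cs := flatten (map f C).
have /choice[g gP] : forall a, exists d, a \in A -> d \in cs /\
    mdist d a <= r / 2 ^+ m.
  move=> a; have [aA|_] := boolP (a \in A); last by exists a.
  have [c cC /(proj2 (fP c))[d dc da]] := AC a aA; exists d => _; split=> //.
  by apply/flattenP; exists (f c) => //; exact: map_f.
have inj : {in A &, injective g}.
  move=> a b aA bA gab; apply: contrapT => /eqP ab.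
  have := sep a b aA bA ab; apply/negP; rewrite -leNgt.
  have [_ ga] := gP a aA; have [_ gb] := gP b bA.
  have := metric_triangle a (g a) b; rewrite (metric_sym a (g a)).
  rewrite -gab in gb; lra.
rewrite -(card_image inj).
apply: (@leq_trans #|` [fset x in cs]|).
  apply: fsubset_leq_card; apply/fsubsetP => _ /imfsetP[a /= aA ->].
  by rewrite !inE; case: (gP a aA).
rewrite card_fseq; apply: leq_trans (size_undup _) _.
rewrite /cs.
elim: (enum_fset C) => //= c s IH; rewrite size_cat mulSn leq_add //.
by case: (fP c).
Qed.

Lemma doubling_halving (D : R) :
  doubling U D -> halving (Num.truncn (2 `^ D)).
Proof.
move=> dU p r; have [cs [szcs csP]] := dU p r; exists cs; split=> //.
by rewrite truncn_ge_nat // powR_ge0.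
Qed.

(** Makes the bounds on successive levels a growing geometric series. Two halvings are taken because
    after one the required separation would equal [mdist p q], where a strict inequality is
    asked. *)
Lemma halving_ge2 N (p q : U) : halving N -> p != q -> (1 < N)%N.
Proof.
move=> hN pq; have d0 : 0 < mdist p q by rewrite mdist_gt0.
have := @packing N 2 [fset p] [fset p; q] (mdist p q) hN.
rewrite cardfs1 cardfs2 pq mul1n => H.
have {H} : (2 <= N ^ 2)%N.
  apply: H => [a|a b].
    rewrite !inE => /orP[]/eqP ->; exists p; rewrite ?inE ?mdistxx ?mdist_ge0 //.
  have -> : 2 ^+ 2 = 4 :> R by rewrite expr2 -natrM.
  rewrite !inE => /orP[]/eqP -> /orP[]/eqP ->; rewrite ?eqxx //;
    rewrite ?(metric_sym q p); lra.
by case: N {hN} => [|[]].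
Qed.

End Packing.

Section CoverTree.
Context (R : realType) (U : metricType R) (S : {fset U}) (T : cover_tree U).
Hypothesis hT : is_cover_tree S T.
Implicit Types (l : int) (n k : nat) (p q : U).

Lemma level_le_top l p : p \in ct_level T l -> l <= ct_top T.
Proof.
by move=> pl; rewrite leNgt; apply/negP => /(ct_above hT) E; rewrite E inE in pl.
Qed.

Lemma level_sub l p : p \in ct_level T l -> p \in S.
Proof. exact/fsubsetP/(ct_sub hT). Qed.

Lemma level_nested l l' p : l' <= l -> p \in ct_level T l -> p \in ct_level T l'.
Proof.
move=> l'l pl; have -> : l' = l - `|l - l'|%N%:Z by lia.
elim: `|l - l'|%N => [|n IH]; first by rewrite subr0.
have -> : l - n.+1%:Z = l - n%:Z - 1 by lia.
exact: (fsubsetP (ct_nesting hT _)) IH.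
Qed.

(** The covering radius of a parent equals the strict separation of its level, so no other point of
    level [l + 1] is close enough to be the parent. *)
Lemma parent_self l p : p \in ct_level T l -> p \in ct_level T (l + 1) ->
  ct_parent T l p = p.
Proof.
move=> pl pl1; have lt : l < ct_top T by have := level_le_top pl1; lia.
apply/eqP; rewrite eq_sym; apply: contraT => ne.
have := ct_separation hT pl1 (ct_parentP hT lt pl) ne.
by rewrite ltNge (ct_covering hT lt pl).
Qed.

Fixpoint ancestor n l q : U :=
  if n is n'.+1 then ancestor n' (l + 1) (ct_parent T l q) else q.

Lemma ancestor_level n l q : q \in ct_level T l -> l + n%:Z <= ct_top T ->
  ancestor n l q \in ct_level T (l + n%:Z).
Proof.
elim: n l q => [|n IH] l q ql ln /=; first by rewrite addr0.
have -> : l + n.+1%:Z = l + 1 + n%:Z by lia.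
apply: IH; last by lia.
by apply: (ct_parentP hT) => //; lia.
Qed.

(** The sum of [2 ^ (l + 1)] up to [2 ^ (l + n)], kept in closed form: without the subtracted term
    the bound would not be inductive. *)
Lemma ancestor_dist n l q : q \in ct_level T l -> l + n%:Z <= ct_top T ->
  mdist q (ancestor n l q) <= 2 ^ (l + n%:Z + 1) - 2 ^ (l + 1).
Proof.
elim: n l q => [|n IH] l q ql ln /=; first by rewrite mdistxx addr0 subrr.
have lt : l < ct_top T by lia.
have := IH (l + 1) _ (ct_parentP hT lt ql).
rewrite (_ : l + 1 + n%:Z = l + n.+1%:Z); last lia.
move=> /(_ ln); have := ct_covering hT lt ql.
have := metric_triangle q (ct_parent T l q) (ancestor n (l + 1) (ct_parent T l q)).
by rewrite (pow2S _ (l + 1)); lra.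
Qed.

Lemma ancestor_self n l q : q \in ct_level T (l + n%:Z) -> ancestor n l q = q.
Proof.
elim: n l => [|n IH] l ql //=.
rewrite parent_self.
    by apply: IH; rewrite (_ : l + 1 + n%:Z = l + n.+1%:Z); last lia.
  by apply: level_nested ql; lia.
by apply: level_nested ql; lia.
Qed.

Lemma ancestorD a b l q :
  ancestor (a + b) l q = ancestor b (l + a%:Z) (ancestor a l q).
Proof.
elim: a l q => [|a IH] l q; first by rewrite addr0.
by rewrite addSn /= IH; congr ancestor; lia.
Qed.

(** Between the two starting levels the point is its own ancestor. Hence the ancestor at level [l]
    depends on the point alone, and subtrees rooted at one level are disjoint. *)
Lemma ancestor_unique l a b q : q \in ct_level T (l - a%:Z) ->
  q \in ct_level T (l - b%:Z) ->
  ancestor a (l - a%:Z) q = ancestor b (l - b%:Z) q.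
Proof.
wlog ab : a b / (a <= b)%N => [H qa qb|qa qb].
  by have [ab|/ltnW ba] := leqP a b; [exact: H|symmetry; exact: H].
rewrite -(subnK ab) ancestorD [ancestor (b - a) _ _]ancestor_self.
  by congr ancestor; lia.
by rewrite (_ : _ + _ = l - a%:Z); last lia.
Qed.

Lemma level_below l q : q \in S -> exists n, q \in ct_level T (l - n%:Z).
Proof.
move=> /(ct_all hT)[l' ql']; exists `|l - l'|%N.
by apply: level_nested ql'; lia.
Qed.

Lemma level_net l q : l <= ct_top T -> q \in S ->
  exists n, [/\ q \in ct_level T (l - n%:Z),
    ancestor n (l - n%:Z) q \in ct_level T l
  & mdist q (ancestor n (l - n%:Z) q) <= 2 ^ (l + 1)].
Proof.
move=> lt qS; have [n qn] := level_below l qS; exists n; split=> //.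
  by rewrite -[X in ct_level T X](subrK n%:Z); apply: ancestor_level;
    rewrite // subrK.
have := @ancestor_dist n (l - n%:Z) q qn; rewrite subrK => /(_ lt) H.
by apply: le_trans H _; have := pow2_gt0 R (l - n%:Z + 1); lra.
Qed.

Lemma level_all : exists n, S `<=` ct_level T (ct_top T - n%:Z).
Proof.
suff [n H] : exists n, {subset enum_fset S <= ct_level T (ct_top T - n%:Z)}.
  by exists n; apply/fsubsetP.
have: {subset enum_fset S <= S} by [].
elim: (enum_fset S) => [|q s IH] sS; first by exists 0%N.
have [|n nP] := IH; first by move=> x xs; apply: sS; rewrite inE xs orbT.
have [|n' qn] := @level_below (ct_top T) q; first by apply: sS; rewrite mem_head.
exists (maxn n n') => x; rewrite inE => /predU1P[->|/nP xn].
  by apply: level_nested qn; lia.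
by apply: level_nested xn; lia.
Qed.

Lemma children_level l p q : q \in ct_children T l p -> q \in ct_level T (l - 1).
Proof. by rewrite !inE => /andP[]. Qed.

Lemma children_self l p : p \in ct_level T l -> p \in ct_children T l p.
Proof.
move=> pl; have pl1 : p \in ct_level T (l - 1) by apply: level_nested pl; lia.
by rewrite !inE pl1 /= parent_self // subrK.
Qed.

Lemma level_children l q : l <= ct_top T -> q \in ct_level T (l - 1) ->
  ct_parent T (l - 1) q \in ct_level T l /\
  q \in ct_children T l (ct_parent T (l - 1) q).
Proof.
move=> lt ql; split; last by rewrite !inE ql eqxx.
by rewrite -{2}[l](subrK 1); apply: (ct_parentP hT) => //; lia.
Qed.

(** Some point of [S] is missing from level [l]. At the highest level below where it occurs its
    parent is another point, at distance at most [2 ^ l]. *)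
Lemma min_distance_le l : (#|` ct_level T l| < #|` S|)%N -> l <= ct_top T ->
  inf (distances S) <= 2 ^ l.
Proof.
move=> lS lt.
have [q qS ql] : exists2 q, q \in S & q \notin ct_level T l.
  apply/exists2P; apply: contrapT => /forallNP H.
  have /fsubset_leq_card : S `<=` ct_level T l.
    apply/fsubsetP => q qS; apply: contrapT => ql.
    by apply: (H q); split=> //; apply/negP.
  by rewrite leqNgt lS.
have ex : exists n, q \in ct_level T (l - n%:Z) by exact: level_below.
case: (ex_minnP ex) => [[|n]] qn nmin; first by rewrite subr0 (negbTE ql) in qn.
have lt' : l - n.+1%:Z < ct_top T by lia.
have pn := ct_parentP hT lt' qn; have := ct_covering hT lt' qn.
rewrite (_ : l - n.+1%:Z + 1 = l - n%:Z) in pn *; last lia.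
set p := ct_parent _ _ _ in pn *; move=> qp.
have qNp : q != p.
  apply/eqP => E; rewrite -E in pn; have := nmin _ pn; lia.
apply: le_trans (remote_edge_le qS (level_sub pn) qNp) _.
by apply: le_trans qp _; apply: ler_pow2; lia.
Qed.

Lemma min_distance_gt0 : (1 < #|` S|)%N -> 0 < inf (distances S).
Proof.
move=> S1; have [n nP] := level_all.
apply: lt_le_trans (pow2_gt0 R (ct_top T - n%:Z)) _.
apply: le_remote_edge => // p q pS qS pq; apply/ltW/(ct_separation hT) => //;
  exact: (fsubsetP nP).
Qed.

Lemma distance_le_max p q : p \in S -> q \in S -> p != q ->
  mdist p q <= sup (distances S).
Proof.
move=> pS qS pq; apply: ub_le_sup; last by exists p, q.
exists (\sum_(a <- S) \sum_(b <- S) mdist a b) => _ [a [b [aS bS _ ->]]].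
rewrite (big_fsetD1 a) //= (big_fsetD1 b) //= -addrA lerDl.
by apply: addr_ge0; apply: sumr_ge0 => *; last apply: sumr_ge0 => *;
  exact: mdist_ge0.
Qed.

(** Ancestors at level [l] are within [2 ^ (l + 1)], while the separation [2 ^ (l - n)] is twice
    [2 ^ (l + 1) / 2 ^ n.+2]; hence the exponent. *)
Lemma level_card N l n : halving U N -> l <= ct_top T ->
  (#|` ct_level T (l - n%:Z)| <= #|` ct_level T l| * N ^ n.+2)%N.
Proof.
move=> hN lt; apply: (@packing R U N n.+2 _ _ (2 ^ (l + 1))) => //.
  move=> a an; exists (ancestor n (l - n%:Z) a).
    by have := ancestor_level (n := n) an; rewrite subrK; apply.
  rewrite metric_sym; have := ancestor_dist (n := n) an; rewrite subrK => /(_ lt) H.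
  by apply: le_trans H _; have := pow2_gt0 R (l - n%:Z + 1); lra.
move=> a b an bn ab; apply: le_lt_trans (ct_separation hT an bn ab).
have -> : l + 1 = l - n%:Z + n.+1%:Z by lia.
rewrite pow2D (exprS _ n.+1) -mulf_div divff ?expf_neq0 ?pnatr_eq0 // mulr1.
by lra.
Qed.

End CoverTree.

(** * Explicit representation *)

Section XTree.
Context (U : choiceType).
Implicit Types (t u : xtree U) (L : seq (xtree U)).

Definition xlevel t : int := let: XNode _ l _ _ := t in l.
Definition xaugmentation t := let: XNode _ _ a _ := t in a.
Definition xchildren t : seq (xtree U) := let: XNode _ _ _ ts := t in ts.

Definition delegates t : seq U :=
  if xaugmentation t is Some (_, B) then B else [::].

(** The points that the next level gains below the node. A leaf or a coalesced chain gains none,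
    whichever of its inner nodes is meant. *)
Definition extras t : seq U :=
  [seq p <- map (@xpoint U) (xchildren t) | p != xpoint t].

(* The nodes of level [l] below a node of level [l + 1]. *)
Definition expand (l : int) t : seq (xtree U) :=
  if xchildren t is c :: _ then
    if l <= xlevel c then xchildren t else [:: t]
  else [:: t].

Definition step (l : int) L : seq (xtree U) := flatten (map (expand l) L).

Definition xtree_nested_ind (P : xtree U -> Prop)
    (H : forall p l a ts, (forall t, List.In t ts -> P t) ->
      P (XNode p l a ts)) : forall t, P t :=
  fix IH t : P t :=
    let: XNode p l a ts := t in
    H p l a ts ((fix IHs (ts : seq (xtree U)) : forall t, List.In t ts -> P t :=
      match ts return forall t, List.In t ts -> P t with
      | [::] => fun t F => False_ind (P t) F
      | t0 :: ts' => fun t F =>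
          match F with
          | or_introl E => eq_ind t0 P (IH t0) t E
          | or_intror F' => IHs ts' t F'
          end
      end) ts).

(** Nodes are not given an equality test, so they are listed with [List.In], and [\in] is used for
    their points. *)
Lemma In_mem_map (T : Type) (A : eqType) (f : T -> A) (s : seq T) x :
  List.In x s -> f x \in map f s.
Proof.
elim: s => //= y s IH [->|/IH]; rewrite inE ?eqxx // => ->; exact: orbT.
Qed.

Lemma mem_map_In (T : Type) (A : eqType) (f : T -> A) (s : seq T) a :
  a \in map f s -> exists2 x, List.In x s & f x = a.
Proof.
elim: s => //= y s IH; rewrite inE => /predU1P[->|/IH[x xs fx]].
  by exists y; first left.
by exists x; first right.
Qed.

Lemma In_flatten_map (T T' : Type) (f : T -> seq T') (s : seq T) y :
  List.In y (flatten (map f s)) -> exists2 x, List.In x s & List.In y (f x).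
Proof.
elim: s => //= x s IH /(@List.in_app_or T' _ _ _)[yx|/IH[z zs yz]].
  by exists x; first left.
by exists z; first right.
Qed.

Lemma subtree_pointsP t q : q \in subtree_points t <->
  q = xpoint t \/ exists2 u, List.In u (xchildren t) & q \in subtree_points u.
Proof.
case: t => p l a ts /=; rewrite !inE.
have foldP : q \in foldr (fun t' X => subtree_points t' `|` X) fset0 ts <->
    exists2 u, List.In u ts & q \in subtree_points u.
  elim: ts => [|u ts IH] /=; first by rewrite inE; split=> // -[].
  rewrite inE; split.
    by case/orP => [qu|/IH[v vts qv]]; [exists u; first left|exists v; first right].
  case=> v [<-->//|vts qv]; apply/orP; right; apply/IH; by exists v.
split.
  by case/predU1P => [->|/foldP]; [left|right].
by case=> [->|/foldP ->]; rewrite ?eqxx ?orbT.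
Qed.

Lemma xpoint_subtree t : xpoint t \in subtree_points t.
Proof. by apply/subtree_pointsP; left. Qed.

Lemma augmented_child indep t u :
  augmented indep t -> List.In u (xchildren t) -> augmented indep u.
Proof.
by case: t => p l a ts /= [_]; elim: ts => //= v ts IH [av ats] [<-//|]; exact: IH.
Qed.

Lemma augmented_step indep l L :
  (forall t, List.In t L -> augmented indep t) ->
  forall t, List.In t (step l L) -> augmented indep t.
Proof.
move=> H t tL; have [u /H uA] := In_flatten_map tL; rewrite /expand.
case E: (xchildren u) => [|c cs]; first by case=> // <-.
case: ifP => _; last by case=> // <-.
by rewrite -E; exact: augmented_child.
Qed.

Lemma augmented_delegates indep t : augmented indep t ->
  uniq (delegates t) /\
  maximal_independent indep (subtree_points t) [fset q in delegates t].
Proof.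
by case: t => p l a ts [[B [-> uB mB]] _].
Qed.

(** A smaller independent set could be extended by one point. So a node offers [k] delegates, or its
    whole subtree when that is smaller. *)
Lemma maximal_bounded_card k (S X I : {fset U}) : X `<=` S ->
  maximal_independent (bounded_card k S) X I ->
  I `<=` X /\ (#|` I| = minn k #|` X|)%N.
Proof.
move=> XS [IX [IS Ik] maxI]; split=> //.
have IleX := fsubset_leq_card IX.
apply/eqP; rewrite eqn_leq leq_min Ik IleX /= leqNgt; apply/negP => lt.
have [|J [IJ JX cJ]] := @fsubset_extend _ I X #|` I|.+1 IX; first by lia.
have := maxI J IJ JX; rewrite /bounded_card /= cJ => JI.
have {}JI : J = I by apply: JI; split; [exact: fsubset_trans JX XS|lia].
by move: cJ; rewrite JI; lia.
Qed.

End XTree.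

Section Explicit.
Context (R : realType) (U : metricType R) (S : {fset U}) (T : cover_tree U).
Hypothesis hT : is_cover_tree S T.
Implicit Types (l : int) (n k : nat) (p q : U) (t u : xtree U).

(* [u] stands for the node of level [l] with point [xpoint u], which may be an
   inner node of the chain coalesced into [u]. *)
Definition represents l u : Prop :=
  exists l', [/\ explicit_at T l' (xpoint u) u, xpoint u \in ct_level T l',
    l <= l' & forall t, List.In t (xchildren u) -> xlevel t < l].

Lemma explicit_level l p u : explicit_at T l p u -> xlevel u = l.
Proof. by case. Qed.

Lemma explicit_point l p u : explicit_at T l p u -> xpoint u = p.
Proof. by case. Qed.

Lemma represents_level l u : represents l u -> xpoint u \in ct_level T l.
Proof. by case=> l' [_ ul' ll' _]; exact: (level_nested hT ll'). Qed.

Lemma explicit_represents l p u : explicit_at T l p u -> p \in ct_level T l ->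
  represents l u.
Proof.
move=> eu pl; exists l; rewrite (explicit_point eu); split=> //.
case: l p u / eu {pl} => //=.
  by move=> l p a lo t lol _ _ et u [<-|//]; rewrite (explicit_level et); lia.
by move=> l p a ts _ _ _ ets t /ets/explicit_level ->; lia.
Qed.

(** Opened or kept, a node yields the points of its children in [T]: inside a coalesced chain the
    only child has the same point. *)
Lemma expandP l u : represents l u ->
  [/\ uniq (map (@xpoint U) (expand (l - 1) u)),
      map (@xpoint U) (expand (l - 1) u) =i ct_children T l (xpoint u),
      extras u = [seq q <- map (@xpoint U) (expand (l - 1) u) | q != xpoint u]
    & forall t, List.In t (expand (l - 1) u) -> represents (l - 1) t].
Proof.
case=> l' [eu ul' ll' H].
have stay : (forall t, List.In t (xchildren u) -> xlevel t < l - 1) ->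
    represents (l - 1) u.
  by move=> H'; exists l'; split=> //; lia.
move: eu ul' ll' H stay; rewrite /extras.
move: {1}(xpoint u) => p0 eu; case: l' p0 u / eu.
- rewrite /expand /= => l' p a chs pl ll' _ st; split=> //.
  + by move=> q; rewrite chs //; rewrite !inE.
  + by rewrite eqxx.
  + by move=> t [<-|//]; exact: st.
- rewrite /expand /= => l' p a lo t lol chs _ et pl ll' H st.
  have lt := explicit_level et; have pt := explicit_point et.
  have {}H : lo - 1 < l by rewrite -lt; apply: H; left.
  rewrite lt pt; case: ifP => lol1; split=> //=; rewrite ?pt ?eqxx //.
  + by move=> q; rewrite chs ?inE //; lia.
  + move=> u [<-|//]; have -> : l - 1 = lo - 1 by lia.
    by apply: explicit_represents et _; apply: (level_nested hT) pl; lia.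
  + by move=> q; rewrite chs ?inE //; lia.
  + by move=> u [<-|//]; apply: st => v [<-|//]; rewrite lt; lia.
- move=> l' p a ts chs uts tsE ets pl ll' H st.
  have {}pl : p \in ct_level T l' := pl.
  have [c [cs tsc]] : exists c cs, ts = c :: cs.
    case: ts tsE {uts ets H st} => [|c cs] tsE; last by exists c, cs.
    by have := children_self hT pl; rewrite -tsE.
  have lc : xlevel c = l' - 1.
    by apply/explicit_level/ets; rewrite tsc; left.
  (* The children of a branching node are exactly one level lower, so it cannot stand for a node
     below its own level. *)
  have {H} ll : l = l' by have : xlevel c < l by [apply: H; rewrite tsc; left]; lia.
  have -> : expand (l - 1) (XNode p l' a ts) = ts.
    by rewrite /expand /= tsc lc ll lexx.
  rewrite ll; split=> // t tts.
  apply: explicit_represents (ets _ tts) _.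
  by apply: (children_level (p := p)); rewrite -tsE; exact: In_mem_map.
Qed.

Definition lists_level l (L : seq (xtree U)) : Prop :=
  [/\ uniq (map (@xpoint U) L), map (@xpoint U) L =i ct_level T l
    & forall t, List.In t L -> represents l t].

Lemma lists_level_size l L : lists_level l L -> size L = #|` ct_level T l|.
Proof.
case=> uL LE _; rewrite -(size_map (@xpoint U)).
by apply/perm_size/uniq_perm => //; exact: fset_uniq.
Qed.

Lemma map_step l (L : seq (xtree U)) : map (@xpoint U) (step l L) =
  flatten (map (fun u => map (@xpoint U) (expand l u)) L).
Proof. by rewrite /step map_flatten -map_comp. Qed.

Lemma lists_level_step l L : l <= ct_top T -> lists_level l L ->
  lists_level (l - 1) (step (l - 1) L).
Proof.
move=> lt [uL LE Lrep]; split.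
- rewrite map_step; elim: L uL Lrep {LE} => //= u L IH /andP[uNL uL] Lrep.
  have [ue eE _ _] := expandP (Lrep u (or_introl erefl)).
  rewrite cat_uniq ue IH //=; last by move=> t tL; apply: Lrep; right.
  rewrite andbT; apply/hasPn => q /flattenP[_ /mem_map_In[v vL <-] qv].
  have [_ veE _ _] := expandP (Lrep v (or_intror vL)).
  move: qv; rewrite veE eE !inE => /andP[_ /eqP qv].
  rewrite qv; apply/negP => /andP[_ /eqP vu].
  by move: uNL; rewrite -vu => /negP[]; exact: In_mem_map.
- move=> q; rewrite map_step; apply/flattenP/idP => [[_ /mem_map_In[u ul <-]]|ql].
    by have [_ -> _ _] := expandP (Lrep u ul); exact: children_level.
  have [pl qc] := level_children hT lt ql.
  move: pl; rewrite -LE => /mem_map_In[u uL' up].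
  exists (map (@xpoint U) (expand (l - 1) u)).
    exact: (In_mem_map (fun u => map (@xpoint U) (expand (l - 1) u))).
  by have [_ -> _ _] := expandP (Lrep u uL'); rewrite up.
- by move=> t tL; have [u /Lrep/expandP[_ _ _ H] /H] := In_flatten_map tL.
Qed.

(** Every node survives as its own child, so the growth is due to the extras alone, and the size of
    the next level is known without building it. *)
Lemma size_step l L : lists_level l L -> l <= ct_top T ->
  size (step (l - 1) L) = (size L + \sum_(u <- L) size (extras u))%N.
Proof.
case=> _ _ Lrep lt; rewrite /step size_flatten /shape -map_comp sumnE big_map.
rewrite -sum1_size -big_split /=; elim: L Lrep => [|u L IH] Lrep.
  by rewrite !big_nil.
rewrite !big_cons IH; last by move=> t tL; apply: Lrep; right.
congr (_ + _)%N.
have urep := Lrep u (or_introl erefl).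
have [ue eE -> _] := expandP urep.
rewrite size_filter -(size_map (@xpoint U)) -[LHS](count_predC (pred1 (xpoint u))).
by rewrite count_uniq_mem // eE (children_self hT) //; exact: represents_level.
Qed.

Lemma child_represents l u t : represents l u -> List.In t (xchildren u) ->
  exists n : nat, represents (l - n%:Z) t /\
    ancestor T n (l - n%:Z) (xpoint t) = xpoint u.
Proof.
move=> ru; have ul := represents_level ru; have [l' [eu ul' ll' H]] := ru.
move: eu ul ul' ll' H {ru}; move: {1}(xpoint u) => p0 eu.
case: l' p0 u / eu => //=.
- move=> l' p a lo v lol chs _ et pl pl' ll' H [vt|//].
  rewrite {v}vt in et H; have pt := explicit_point et.
  have {}H : lo - 1 < l by rewrite -(explicit_level et); apply: H; left.
  exists `|(l - (lo - 1))%R|%N; rewrite (_ : l - _ = lo - 1); last by lia.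
  split; last first.
    rewrite pt; apply: (ancestor_self hT).
    by rewrite (_ : lo - 1 + _ = l); last lia.
  by apply: explicit_represents et _; apply: (level_nested hT) pl; lia.
- move=> l' p a ts chs uts tsE ets pl pl' ll' H tts.
  have {}H : l = l'.
    by have := H t tts; rewrite (explicit_level (ets _ tts)); lia.
  have : xpoint t \in ct_children T l' p by rewrite -tsE; exact: In_mem_map.
  rewrite !inE => /andP[tl /eqP tp]; exists 1%N; rewrite H; split=> //.
  exact: explicit_represents (ets _ tts) _.
Qed.

(** Disjointness, covering and diameter of the explicit subtrees are all read off ancestors in [T].
    The converse direction is by induction on levels, since several levels may share one explicit
    node. *)
Lemma subtreeP l u q : represents l u -> l <= ct_top T ->
  q \in subtree_points u <-> exists n, q \in ct_level T (l - n%:Z) /\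
    ancestor T n (l - n%:Z) q = xpoint u.
Proof.
move=> ru lt; split.
  elim/xtree_nested_ind: u l ru {lt} => p l0 a ts IH l ru.
  move/subtree_pointsP=> [->|[t tts qt]].
    by exists 0%N; rewrite subr0; split=> //; exact: represents_level ru.
  have [n [rt <-]] := child_represents ru tts.
  have [n' [qn <-]] := IH t tts _ rt qt; exists (n' + n)%N.
  have E : l - (n' + n)%N%:Z = l - n%:Z - n'%:Z by lia.
  rewrite E; split=> //; rewrite ancestorD; congr ancestor; lia.
case=> n; elim: n l u ru lt => [|n IH] l u ru lt [ql qa].
  by apply/subtree_pointsP; left.
have E : l - n.+1%:Z = l - 1 - n%:Z by lia.
have := qa; rewrite -addn1 ancestorD addn1 E (_ : _ + n%:Z = l - 1); last lia.
set p := ancestor T n _ q => /= pu.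
have pl : p \in ct_level T (l - 1).
  rewrite E in ql; have := ancestor_level hT (n := n) ql.
  by rewrite subrK; apply; lia.
have [_ eE _ erep] := expandP ru.
have : p \in ct_children T l (xpoint u) by rewrite !inE pl pu eqxx.
rewrite -eE => /mem_map_In[t te tp].
have qt : q \in subtree_points t.
  by apply: (IH (l - 1)); [exact: erep|lia|split; [rewrite -E|rewrite tp]].
move: te; rewrite /expand; case C: (xchildren u) => [|c cs].
  by case=> // ->.
case: ifP => _; last by case=> // ->.
by rewrite -C => tc; apply/subtree_pointsP; right; exists t.
Qed.

Lemma subtree_sub l u : represents l u -> l <= ct_top T ->
  subtree_points u `<=` S.
Proof.
move=> ru lt; apply/fsubsetP => q /(subtreeP _ ru lt)[n [qn _]].
exact: (level_sub hT) qn.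
Qed.

Lemma subtree_disjoint l u v q : represents l u -> represents l v ->
  l <= ct_top T -> q \in subtree_points u -> q \in subtree_points v ->
  xpoint u = xpoint v.
Proof.
move=> ru rv lt /(subtreeP _ ru lt)[a [qa <-]] /(subtreeP _ rv lt)[b [qb <-]].
exact: (ancestor_unique hT).
Qed.

Lemma subtree_dist l u q : represents l u -> l <= ct_top T ->
  q \in subtree_points u -> mdist q (xpoint u) <= 2 ^ (l + 1).
Proof.
move=> ru lt /(subtreeP _ ru lt)[n [qn <-]].
have := ancestor_dist hT (n := n) qn; rewrite subrK => /(_ lt) H.
by apply: le_trans H _; have := pow2_gt0 R (l - n%:Z + 1); lra.
Qed.

Lemma subtree_cover l L q : lists_level l L -> l <= ct_top T -> q \in S ->
  exists2 u, List.In u L & q \in subtree_points u.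
Proof.
move=> [_ LE Lrep] lt qS; have [n [qn qa _]] := level_net hT lt qS.
move: qa; rewrite -LE => /mem_map_In[u uL up].
by exists u => //; apply/(subtreeP _ (Lrep u uL) lt); exists n.
Qed.

Lemma extras_subtree l u q : represents l u -> q \in extras u ->
  q \in subtree_points u /\ q \in ct_level T (l - 1).
Proof.
move=> ru; have [_ eE -> _] := expandP ru.
rewrite mem_filter eE => /andP[qu qc]; split; last exact: children_level qc.
have := qc; rewrite -eE => /mem_map_In[t + tq]; rewrite /expand.
have uq : xpoint u = q -> q \in subtree_points u.
  by move=> <-; exact: xpoint_subtree.
case C: (xchildren u) => [|c cs]; first by case=> // E; apply: uq; rewrite E.
case: ifP => _; last by case=> // E; apply: uq; rewrite E.
rewrite -C => tc; apply/subtree_pointsP; right; exists t => //.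
by rewrite -tq; exact: xpoint_subtree.
Qed.

Lemma uniq_point_extras l u : represents l u -> uniq (xpoint u :: extras u).
Proof.
move=> ru; have [ue _ -> _] := expandP ru.
by rewrite /= mem_filter eqxx /= filter_uniq.
Qed.

End Explicit.

(** * Coresets *)

Lemma uniq_flatten_map (T : Type) (A : eqType) (f : T -> seq A) (s : seq T) :
  (forall x, List.In x s -> uniq (f x)) ->
  List.ForallOrdPairs (fun x y => forall a, a \in f x -> a \notin f y) s ->
  uniq (flatten (map f s)).
Proof.
move=> + H; elim: s / H => [|x s xs _ IH] //= uf.
rewrite cat_uniq uf ?IH /= ?andbT; [|by move=> y ys; apply: uf; right|by left].
apply/hasPn => a /flattenP[_ /mem_map_In[y ys <-] ay]; apply/negP => ax.
by have /List.Forall_forall/(_ y ys a ax) := xs; rewrite ay.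
Qed.

Lemma In_map (A B : Type) (f : A -> B) (s : seq A) y :
  List.In y (map f s) -> exists2 x, List.In x s & f x = y.
Proof.
elim: s => //= x s IH [<-|/IH[z zs <-]]; first by exists x; first left.
by exists z; first right.
Qed.

(* Every node is grouped with the points of its children, until [b] such points
   have been collected. *)
Fixpoint group (U : choiceType) (L : seq (xtree U)) (b : nat) :
    seq (xtree U * seq U) * nat :=
  if L is u :: L' then
    let E := take b (extras u) in
    let r := group L' (b - size E) in ((u, E) :: r.1, r.2)
  else ([::], b).

Definition group_points (U : choiceType) (g : xtree U * seq U) : seq U :=
  xpoint g.1 :: g.2.

Definition group_delegates (U : choiceType) (aug : bool)
    (g : xtree U * seq U) : seq U :=
  [seq x <- (if aug then delegates g.1 else [::]) | x \notin group_points g].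

Definition coreset (U : choiceType) (aug : bool) (G : seq (xtree U * seq U)) :
    seq U :=
  flatten (map (fun g => group_points g ++ group_delegates aug g) G).

Section Groups.
Context (U : choiceType).
Implicit Types (L : seq (xtree U)) (G : seq (xtree U * seq U)) (b : nat).

Lemma group_nodes L b : map fst (group L b).1 = L.
Proof. by elim: L b => //= u L IH b; rewrite IH. Qed.

(** With [b = k - size L] the remaining budget is 0 exactly when the next level has at least [k]
    nodes: this is the stopping test of the search. *)
Lemma group_budget L b :
  (group L b).2 = (b - \sum_(u <- L) size (extras u))%N.
Proof.
elim: L b => [|u L IH] b /=; first by rewrite big_nil subn0.
by rewrite IH big_cons size_take_min; lia.
Qed.

Lemma group_count L b :
  (\sum_(g <- (group L b).1) size g.2 + (group L b).2 = b)%N.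
Proof.
elim: L b => [|u L IH] b /=; first by rewrite big_nil.
by rewrite big_cons -addnA IH size_take_min; lia.
Qed.

Lemma group_extras L b g : List.In g (group L b).1 ->
  exists n, g.2 = take n (extras g.1).
Proof.
elim: L b => //= u L IH b [<-|/IH//]; by exists b.
Qed.

Lemma mem_coreset aug G g x : List.In g G -> x \in group_points g ->
  x \in coreset aug G.
Proof.
move=> gG xg; apply/flattenP.
exists (group_points g ++ group_delegates aug g).
  exact: (In_mem_map (fun g => group_points g ++ group_delegates aug g)).
by rewrite mem_cat xg.
Qed.

Lemma mem_coreset_delegates G g x : List.In g G -> x \in delegates g.1 ->
  x \in coreset true G.
Proof.
move=> gG xg; apply/flattenP.
exists (group_points g ++ group_delegates true g).
  exact: (In_mem_map (fun g => group_points g ++ group_delegates true g)).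
by rewrite mem_cat mem_filter xg andbT orbN.
Qed.

End Groups.

Section Coreset.
Context (R : realType) (U : metricType R) (S : {fset U}) (T : cover_tree U).
Hypothesis hT : is_cover_tree S T.
Implicit Types (l : int) (k : nat) (G : seq (xtree U * seq U)).

(** Common to both forms of the coreset, with extras cut by a budget and without extras. *)
Definition grouping l G : Prop :=
  lists_level T l (map fst G) /\
  forall g, List.In g G -> exists n, g.2 = take n (extras g.1).

Lemma group_grouping l L b : lists_level T l L -> grouping l (group L b).1.
Proof. by move=> HL; split; [rewrite group_nodes|exact: group_extras]. Qed.

Lemma group_points_uniq l G g : grouping l G -> List.In g G ->
  uniq (group_points g) /\
  forall x, x \in group_points g -> x \in subtree_points g.1 /\
    x \in ct_level T (l - 1).
Proof.
move=> [[_ _ rG] tG] gG.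
have rg : represents T l g.1.
  by apply: rG; apply: (List.in_map fst) gG.
have [n gE] := tG g gG; rewrite /group_points gE; split.
  have := uniq_point_extras hT rg; rewrite /= => /andP[ue un].
  by rewrite take_uniq // andbT; apply: contraNN ue; exact: mem_take.
move=> x; rewrite inE => /predU1P[->|/mem_take]; last exact: (extras_subtree hT).
split; first exact: xpoint_subtree.
by apply: (level_nested hT) (represents_level hT rg); lia.
Qed.

Section Delegates.
Context (l : int) (k : nat) (aug : bool) (G : seq (xtree U * seq U)).
Hypothesis lG : grouping l G.
Hypothesis ltop : l <= ct_top T.
Hypothesis augG : aug -> forall u, List.In u (map fst G) ->
  augmented (bounded_card k S) u.

Let node_rep g : List.In g G -> represents T l g.1.
Proof.
by move=> gG; case: lG => [[_ _ rG] _]; apply: rG; apply: (List.in_map fst) gG.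
Qed.

Lemma coreset_delegates g : aug -> List.In g G ->
  [/\ uniq (delegates g.1), {subset delegates g.1 <= subtree_points g.1}
    & size (delegates g.1) = minn k #|` subtree_points g.1|].
Proof.
move=> a gG; have [ud md] := augmented_delegates (augG a (List.in_map fst _ _ gG)).
have sS := subtree_sub hT (node_rep gG) ltop.
have [/fsubsetP ds cd] := maximal_bounded_card sS md; split=> //.
  by move=> x xd; apply: ds; rewrite !inE.
by rewrite -cd card_fseq undup_id.
Qed.

Lemma group_subtree g x : List.In g G ->
  x \in group_points g ++ group_delegates aug g -> x \in subtree_points g.1.
Proof.
move=> gG; rewrite mem_cat mem_filter.
case/orP => [/(proj2 (group_points_uniq lG gG))[]//|/andP[_]].
case: ifP => // a; by have [_ ds _] := coreset_delegates a gG; exact: ds.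
Qed.

(** Groups lie in the disjoint subtrees of distinct nodes of one level, so duplicates have to be
    removed only within a group. *)
Lemma uniq_coreset : uniq (coreset aug G).
Proof.
apply: uniq_flatten_map => [g gG|].
  have [ug _] := group_points_uniq lG gG.
  rewrite cat_uniq ug /= -all_predC; apply/andP; split.
    by apply/allP => x; rewrite mem_filter => /andP[].
  rewrite filter_uniq //; case: ifP => // a.
  by have [] := coreset_delegates a gG.
have [[uG _ _] _] := lG.
suff H G' : uniq (map (@xpoint U) (map fst G')) ->
    (forall g, List.In g G' -> List.In g G) ->
    List.ForallOrdPairs (fun x y => forall a,
      a \in group_points x ++ group_delegates aug x ->
      a \notin group_points y ++ group_delegates aug y) G'.
  exact: H uG _.
elim: G' => [|g G' IH]; first by constructor.
case/andP=> gN uG' sub; constructor; last by apply: IH => // h hG; apply: sub; right.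
apply/List.Forall_forall => h hG a ag; apply/negP => ah.
have gG : List.In g G by apply: sub; left.
have hG' : List.In h G by apply: sub; right.
have E := subtree_disjoint hT (node_rep gG) (node_rep hG') ltop
  (group_subtree gG ag) (group_subtree hG' ah).
apply/negP: gN; rewrite negbK [xpoint _]E.
exact: (In_mem_map (@xpoint U) (List.in_map fst _ _ hG)).
Qed.

Lemma coreset_sub : {subset coreset aug G <= S}.
Proof.
move=> x /flattenP[_ /mem_map_In[g gG <-]] /(group_subtree gG).
exact/fsubsetP/(subtree_sub hT (node_rep gG) ltop).
Qed.

Lemma size_coreset : (size (coreset aug G) <=
  \sum_(g <- G) (size g.2).+1 + size G * (if aug then k else 0))%N.
Proof.
rewrite /coreset size_flatten /shape -map_comp sumnE big_map.
rewrite -sum1_size big_distrl -big_split /=.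
have : forall g, List.In g G ->
    (size (group_points g ++ group_delegates aug g) <=
      (size g.2).+1 + 1 * (if aug then k else 0))%N.
  move=> g gG; rewrite size_cat leq_add2l mul1n /group_delegates size_filter.
  apply: leq_trans (count_size _ _) _; case: ifP => // a.
  by have [_ _ ->] := coreset_delegates a gG; rewrite geq_minl.
elim: (G) => [|g G' IH] H; first by rewrite !big_nil.
rewrite !big_cons leq_add //; first by apply: H; left.
by apply: IH => h hG; apply: H; right.
Qed.

End Delegates.

(** The fibres of [a] are clusters. [X] has at most [k] points in a cluster, and no more than the
    cluster itself, hence no more than [P] has there; points of equal rank are matched. *)
Lemma injective_delegation (A P X : {fset U}) (a : U -> U) k delta :
  X `<=` A -> #|` X| = k ->
  (forall p, (minn k (count (fun x => a x == p) A)
    <= count (fun x => a x == p) P)%N) ->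
  (forall x y, x \in A -> y \in P -> a x = a y -> mdist x y <= delta) ->
  exists phi : U -> U, [/\ {in X &, injective phi},
    [fset phi x | x in X] `<=` P
  & forall x, x \in X -> mdist x (phi x) <= delta].
Proof.
move=> XA cX cP dP.
pose Xa p := [seq x <- X | a x == p]; pose Pa p := [seq x <- P | a x == p].
have sz p : (size (Xa p) <= size (Pa p))%N.
  rewrite !size_filter; apply: leq_trans (cP p); rewrite leq_min.
  rewrite -cX count_size /= -!size_filter; apply: uniq_leq_size.
    by rewrite filter_uniq // fset_uniq.
  by move=> x; rewrite !mem_filter => /andP[-> /(fsubsetP XA)].
pose phi x := nth x (Pa (a x)) (index x (Xa (a x))).
have lt x : x \in X -> (index x (Xa (a x)) < size (Pa (a x)))%N.
  by move=> xX; apply: leq_trans (sz _); rewrite index_mem mem_filter eqxx.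
have phiP x : x \in X -> phi x \in P /\ a (phi x) = a x.
  move=> xX; have : phi x \in Pa (a x) by apply: mem_nth; exact: lt.
  by rewrite mem_filter => /andP[/eqP -> ->].
exists phi; split.
- move=> x y xX yX E.
  have axy : a x = a y by rewrite -(proj2 (phiP x xX)) E (proj2 (phiP y yX)).
  move: E; rewrite /phi -axy (set_nth_default x y) ?[in (_ < _)%N]axy ?lt //.
  move/eqP; rewrite nth_uniq ?lt // ?filter_uniq ?fset_uniq //; last first.
    by rewrite axy lt.
  move=> /eqP/(congr1 (nth x (Xa (a x)))).
  by rewrite !nth_index // mem_filter ?eqxx // axy eqxx.
- by apply/fsubsetP => _ /imfsetP[x /= xX ->]; case: (phiP x xX).
- move=> x xX; have [pP ap] := phiP x xX; apply: dP => //.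
  exact: (fsubsetP XA).
Qed.

(** [Q] gives the lower bound [low]. A proxy in the same subtree is within [2 * 2 ^ (l + 1)], and
    both ends of a distance move, whence the factor 4. *)
Lemma coreset_opt m k l l0 G (Q : {fset U}) :
  let P := coreset (uses_augmentation m) G in
  (1 < k <= #|` S|)%N -> grouping l G -> l <= ct_top T ->
  (uses_augmentation m -> forall u, List.In u (map fst G) ->
    augmented (bounded_card k S) u) ->
  #|` Q| = k -> Q `<=` ct_level T l0 -> Q `<=` [fset p in P] ->
  div_opt m k S <= (1 + 4 * (2 ^ (l + 1) / 2 ^ l0)) * div_opt m k [fset p in P].
Proof.
move=> P /andP[k1 kS] lG lt aG cQ Ql QP.
have kP : (k <= #|` [fset p in P]|)%N by rewrite -cQ; exact: fsubset_leq_card.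
have d0 := pow2_gt0 R (l + 1); have s0 := pow2_gt0 R l0.
have low : (total_weight m k)%:R * 2 ^ l0 <= div_opt m k [fset p in P].
  apply: le_trans (div_le_opt m QP cQ).
  apply: le_div_separated => // p q pQ qQ pq; apply/ltW.
  by apply: (ct_separation hT) => //; exact: (fsubsetP Ql).
have /choice[a aP] : forall q, exists p, q \in S -> exists g, [/\ List.In g G,
    p = xpoint g.1 & q \in subtree_points g.1].
  move=> q; have [qS|_] := boolP (q \in S); last by exists q.
  have [u uG qu] := subtree_cover hT (proj1 lG) lt qS.
  by have [g gG gu] := In_map uG; exists (xpoint u) => _; exists g; rewrite gu.
have rG g : List.In g G -> represents T l g.1.
  by move=> gG; case: lG => [[_ _ rG] _]; apply: rG; apply: (List.in_map fst) gG.
have ad q : q \in S -> mdist q (a q) <= 2 ^ (l + 1).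
  move=> /aP[g [gG -> qg]]; exact: (subtree_dist hT (rG g gG) lt).
have high : div_opt m k S <= div_opt m k [fset p in P] +
    (total_weight m k)%:R * (2 * (2 * 2 ^ (l + 1))).
  apply: div_opt_le => // X XS cX.
  have [mA|mA] := boolP (uses_augmentation m); last first.
    have [||x xX|Y [YP cY XY]] :=
        @remote_cover_le R U m X [fset p in P] k a (2 ^ (l + 1)) mA cX.
    - by rewrite k1.
    - exact: ltW.
    - have xS := fsubsetP XS x xX; split; last exact: ad.
      have [g [gG -> _]] := aP x xS; rewrite !inE /=.
      by apply: (mem_coreset _ gG); rewrite mem_head.
    apply: le_trans XY _; apply: lerD; first exact: div_le_opt.
    by rewrite ler_wpM2l // ler_pM2l //; lra.
  have aE g x : List.In g G -> x \in S ->
      (a x == xpoint g.1) = (x \in subtree_points g.1).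
    move=> gG xS; have [h [hG -> xh]] := aP x xS.
    apply/eqP/idP => [E|xg].
      apply/(subtreeP hT _ (rG g gG) lt); rewrite -E.
      exact/(subtreeP hT _ (rG h hG) lt).
    exact: (subtree_disjoint hT (rG h hG) (rG g gG) lt xh xg).
  have [p|x y xS|phi [inj phiP phid]] :=
      @injective_delegation S [fset p in P] X a k (2 * 2 ^ (l + 1)) XS cX.
  - have [[g gG pg]|N] := pselect (exists2 g, List.In g G & p = xpoint g.1); last first.
      rewrite (_ : count _ S = 0%N) ?minn0 //; apply/eqP; rewrite -leqn0 leqNgt.
      rewrite -has_count; apply/hasPn => x xS; apply/eqP => axp; apply: N.
      by have [g [gG ag _]] := aP x xS; exists g; rewrite // -axp.
    have [ud ds sd] := coreset_delegates lG lt aG mA gG.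
    apply: (@leq_trans (size (delegates g.1))).
      rewrite sd leq_min geq_minl /=; apply: leq_trans (geq_minr _ _) _.
      rewrite -size_filter; apply: uniq_leq_size.
        by rewrite filter_uniq // fset_uniq.
      by move=> x; rewrite mem_filter pg => /andP[+ xS]; rewrite aE.
    rewrite -size_filter; apply: uniq_leq_size => // x xd.
    rewrite mem_filter pg aE ?ds //=.
      by rewrite !inE /= /P mA; exact: mem_coreset_delegates xd.
    exact: (fsubsetP (subtree_sub hT (rG g gG) lt)) (ds _ xd).
  - rewrite !inE /= => /(coreset_sub lG lt aG) yS axy.
    have := metric_triangle x (a x) y; have := ad x xS; have := ad y yS.
    by rewrite axy (metric_sym y (a y)); lra.
  apply: le_trans (div_moved_le mA cX _ inj phid) _; first by rewrite (ltn_trans _ k1).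
  rewrite lerD2r; apply: div_le_opt => //; by rewrite card_image.
apply: le_trans high _; rewrite [leRHS]mulrDl mul1r; apply: lerD => //.
have -> : (total_weight m k)%:R * (2 * (2 * 2 ^ (l + 1))) =
  4 * (2 ^ (l + 1) / 2 ^ l0) * ((total_weight m k)%:R * 2 ^ l0) :> R.
  by rewrite -[RHS]mulrA [X in 4 * X]mulrACA mulVf ?gt_eqF // mulr1; lra.
by rewrite ler_wpM2l // mulr_ge0 // divr_ge0 // ltW.
Qed.

End Coreset.

(** * Programs and their costs *)

Section Evaluation.
Context (R : realType) (U : metricType R).
Implicit Types (h : heap R U) (env fe : seq (val R U)) (v w : val R U).

(* Evaluation without side effects: the approximation algorithm has to be applied
   in the very heap that its own evaluation left. *)
Definition evals h env e v (N : nat) : Prop :=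
  exists2 n, eval h env e v h n & (n <= N)%N.

Lemma evals_le h env e v N N' : evals h env e v N -> (N <= N')%N ->
  evals h env e v N'.
Proof. by case=> n en nN NN'; exists n => //; exact: leq_trans NN'. Qed.

Lemma evals_var h env i v : onth env i = Some v -> evals h env (EVar i) v 1.
Proof. by move=> H; exists 1%N => //; constructor. Qed.

Lemma evals_fun h env e : evals h env (EFun e) (VClos env e) 1.
Proof. by exists 1%N => //; constructor. Qed.

Lemma evals_int h env z : evals h env (EInt z) (VInt z) 1.
Proof. by exists 1%N => //; constructor. Qed.

Lemma evals_real h env z : evals h env (EReal z) (VReal z%:~R) 1.
Proof. by exists 1%N => //; constructor. Qed.

Lemma evals_nil h env : evals h env ENil VNil 1.
Proof. by exists 1%N => //; constructor. Qed.

Lemma evals_pair h env e1 e2 v1 v2 N1 N2 :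
  evals h env e1 v1 N1 -> evals h env e2 v2 N2 ->
  evals h env (EPair e1 e2) (VPair v1 v2) (N1 + N2).+1.
Proof.
case=> n1 H1 L1 [n2 H2 L2]; exists (n1 + n2).+1; last by rewrite ltnS leq_add.
exact: EvalPair H1 H2.
Qed.

Lemma evals_prim h env o e1 e2 v1 v2 v N1 N2 :
  evals h env e1 v1 N1 -> evals h env e2 v2 N2 -> prim_sem o v1 v2 = Some v ->
  evals h env (EPrim o e1 e2) v (N1 + N2).+1.
Proof.
case=> n1 H1 L1 [n2 H2 L2] E; exists (n1 + n2).+1; last by rewrite ltnS leq_add.
exact: EvalPrim H1 H2 E.
Qed.

Lemma evals_let h env e1 e2 w v N1 N2 :
  evals h env e1 w N1 -> evals h (w :: env) e2 v N2 ->
  evals h env (ELet e1 e2) v (N1 + N2).+1.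
Proof.
case=> n1 H1 L1 [n2 H2 L2]; exists (n1 + n2).+1; last by rewrite ltnS leq_add.
exact: EvalLet H1 H2.
Qed.

Lemma evals_if_true h env e e1 e2 b v N1 N2 :
  evals h env e (VBool b) N1 -> b = true -> evals h env e1 v N2 ->
  evals h env (EIf e e1 e2) v (N1 + N2).+1.
Proof.
case=> n1 H1 L1 bT [n2 H2 L2]; exists (n1 + n2).+1; last by rewrite ltnS leq_add.
by apply: (EvalIf H1); rewrite bT.
Qed.

Lemma evals_if_false h env e e1 e2 b v N1 N2 :
  evals h env e (VBool b) N1 -> b = false -> evals h env e2 v N2 ->
  evals h env (EIf e e1 e2) v (N1 + N2).+1.
Proof.
case=> n1 H1 L1 bF [n2 H2 L2]; exists (n1 + n2).+1; last by rewrite ltnS leq_add.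
by apply: (EvalIf H1); rewrite bF.
Qed.

Lemma evals_match_nil h env e e0 e1 v N1 N2 :
  evals h env e VNil N1 -> evals h env e0 v N2 ->
  evals h env (EMatch e e0 e1) v (N1 + N2).+1.
Proof.
case=> n1 H1 L1 [n2 H2 L2]; exists (n1 + n2).+1; last by rewrite ltnS leq_add.
exact: EvalMatchNil H1 H2.
Qed.

Lemma evals_match_pair h env e e0 e1 v1 v2 v N1 N2 :
  evals h env e (VPair v1 v2) N1 -> evals h (v1 :: v2 :: env) e1 v N2 ->
  evals h env (EMatch e e0 e1) v (N1 + N2).+1.
Proof.
case=> n1 H1 L1 [n2 H2 L2]; exists (n1 + n2).+1; last by rewrite ltnS leq_add.
exact: EvalMatchPair H1 H2.
Qed.

Definition env1 (b : expr) fe w := [:: w, VClos fe b & fe].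
Definition env2 (b : expr) fe w1 w2 := env1 b (env1 (EFun b) fe w1) w2.
Definition env3 (b : expr) fe w1 w2 w3 := env1 b (env2 (EFun b) fe w1 w2) w3.

Lemma evals_app1 h env f a fe b w v N0 N1 N :
  evals h env f (VClos fe b) N0 -> evals h env a w N1 ->
  evals h (env1 b fe w) b v N ->
  evals h env (EApp f a) v (N0 + N1 + N).+1.
Proof.
case=> n0 H0 L0 [n1 H1 L1] [n H L]; exists (n0 + n1 + n).+1; last by lia.
exact: EvalApp H0 H1 H.
Qed.

Lemma evals_app2 h env f a1 a2 fe b w1 w2 v N0 N1 N2 N :
  evals h env f (VClos fe (EFun b)) N0 -> evals h env a1 w1 N1 ->
  evals h env a2 w2 N2 -> evals h (env2 b fe w1 w2) b v N ->
  evals h env (EApp (EApp f a1) a2) v (N0 + N1 + N2 + N).+3.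
Proof.
move=> H0 H1 H2 H; apply: (@evals_le _ _ _ _ ((N0 + N1 + 1).+1 + N2 + N).+1).
  by apply: evals_app1 H2 H; apply: evals_app1 H0 H1 _; exact: evals_fun.
by lia.
Qed.

Lemma evals_app3 h env f a1 a2 a3 fe b w1 w2 w3 v N0 N1 N2 N3 N :
  evals h env f (VClos fe (EFun (EFun b))) N0 -> evals h env a1 w1 N1 ->
  evals h env a2 w2 N2 -> evals h env a3 w3 N3 ->
  evals h (env3 b fe w1 w2 w3) b v N ->
  evals h env (EApp (EApp (EApp f a1) a2) a3) v (N0 + N1 + N2 + N3 + N + 5).
Proof.
move=> H0 H1 H2 H3 H.
apply: (@evals_le _ _ _ _ ((N0 + N1 + N2 + 1).+3 + N3 + N).+1).
  by apply: evals_app1 H3 H; apply: evals_app2 H0 H1 H2 _; exact: evals_fun.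
by lia.
Qed.

End Evaluation.

(** A hook for function calls, extended below by the specifications of the functions already
    verified. *)
Ltac eval_call := fail.

Ltac evaluate :=
  lazymatch goal with
  | |- evals _ _ (EVar _) _ _ => eapply evals_var; reflexivity
  | |- evals _ _ (EFun _) _ _ => eapply evals_fun
  | |- evals _ _ (EInt _) _ _ => eapply evals_int
  | |- evals _ _ (EReal _) _ _ => eapply evals_real
  | |- evals _ _ ENil _ _ => eapply evals_nil
  | |- evals _ _ (EPair _ _) _ _ => eapply evals_pair; [evaluate|evaluate]
  | |- evals _ _ (EPrim _ _ _) _ _ =>
      eapply evals_prim; [evaluate|evaluate|reflexivity]
  | |- evals _ _ (ELet _ _) _ _ => eapply evals_let; [evaluate|evaluate]
  | |- evals _ _ (EMatch _ _ _) _ _ =>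
      first [eapply evals_match_pair; [solve [evaluate]|]
            |eapply evals_match_nil; [solve [evaluate]|]]; evaluate
  | |- evals _ _ (EIf _ _ _) _ _ =>
      first [eapply evals_if_true; [solve [evaluate]|eassumption|]
            |eapply evals_if_false; [solve [evaluate]|eassumption|]]; evaluate
  | |- evals _ _ (EApp (EApp (EApp _ _) _) _) _ _ =>
      eapply evals_app3; [evaluate|evaluate|evaluate|evaluate|eval_call]
  | |- evals _ _ (EApp (EApp _ _) _) _ _ =>
      eapply evals_app2; [evaluate|evaluate|evaluate|eval_call]
  | |- evals _ _ (EApp _ _) _ _ =>
      eapply evals_app1; [evaluate|evaluate|eval_call]
  | |- evals ?h ?env ?e ?v ?N =>
      let e' := eval hnf in e in change (evals h env e' v N); evaluate
  end.

Ltac unfold_body c :=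
  lazymatch goal with
  | |- evals ?h ?env ?b ?v ?N =>
      let b' := eval unfold c in b in change (evals h env b' v N)
  end.

Tactic Notation "run_body" reference(c) :=
  eapply evals_le; [unfold_body c; evaluate|].

(* In the body of a function of [n] arguments, argument [j] (from 1) has index
   [2 * (n - j)], and the function itself has index [2 * n - 1]. *)
Definition append_body : expr :=
  EMatch (EVar 2) (EVar 0)
    (EPair (EVar 0) (EApp (EApp (EVar 5) (EVar 1)) (EVar 2))).
Definition appendE : expr := EFun (EFun append_body).

(** Points are opaque: equality is observed as a distance that is at most 0. *)
Definition same_point (e1 e2 : expr) : expr :=
  EPrim RLe (EPrim Dist e1 e2) (EReal 0).

Ltac eval_call ::= match goal with IH : _ |- _ => eapply IH end.

Section Lists.
Context (R : realType) (U : metricType R) (h : heap R U).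

Lemma append_evals (T : Type) (enc : T -> val R U) fe (s t : seq T) :
  evals h (env2 append_body fe (enc_seq enc s) (enc_seq enc t)) append_body
    (enc_seq enc (s ++ t)) (20 * (size s).+1).
Proof.
elim: s => [|x s IH].
  by run_body append_body.
run_body append_body.
by simpl; lia.
Qed.

Lemma same_pointE (p q : U) : (mdist p q <= 0%:~R) = (p == q).
Proof. by rewrite leNgt mdist_gt0 negbK. Qed.

End Lists.

(** The arguments are a point, a list of children and a budget. The scan stops once the budget is
    spent, so its cost is charged to the points collected and not to the number of children. *)
Definition extras_body : expr :=
  EMatch (EVar 2) (EPair ENil (EVar 0))
    (EIf (EPrim ILe (EVar 2) (EInt 0)) (EPair ENil (EVar 2))
      (EMatch (EVar 0) ENil
        (EIf (same_point (EVar 8) (EVar 0))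
          (EApp (EApp (EApp (EVar 9) (EVar 8)) (EVar 3)) (EVar 4))
          (EMatch (EApp (EApp (EApp (EVar 9) (EVar 8)) (EVar 3))
                    (EPrim ISub (EVar 4) (EInt 1)))
            ENil
            (EPair (EPair (EVar 2) (EVar 0)) (EVar 1)))))).
Definition extrasE : expr := EFun (EFun (EFun extras_body)).

Definition group_body : expr :=
  EMatch (EVar 2) (EPair ENil (EVar 0))
    (EMatch (EVar 0) ENil
      (EMatch (EVar 1) ENil
        (EMatch (EVar 1) ENil
          (EMatch (EApp (EApp (EApp extrasE (EVar 4)) (EVar 1)) (EVar 8)) ENil
            (EMatch (EApp (EApp (EVar 13) (EVar 9)) (EVar 1)) ENil
              (EPair (EPair (EPair (EVar 10) (EVar 2)) (EVar 0)) (EVar 1))))))).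
Definition groupE : expr := EFun (EFun group_body).

Definition step_body : expr :=
  EMatch (EVar 0) ENil
    (ELet (EApp (EApp (EVar 5) (EVar 4)) (EVar 1))
      (EMatch (EVar 1) ENil
        (EMatch (EVar 1) ENil
          (EMatch (EVar 1) ENil
            (EMatch (EVar 1) (EPair (EVar 7) (EVar 6))
              (EMatch (EVar 0) ENil
                (EMatch (EVar 1) ENil
                  (EIf (EPrim ILe (EVar 17) (EVar 0))
                    (EApp (EApp appendE (EVar 7)) (EVar 12))
                    (EPair (EVar 13) (EVar 12)))))))))).
Definition stepE : expr := EFun (EFun step_body).

(** The arguments are the nodes, their level, and [k] minus the number of nodes. What [group] leaves
    of that budget is the same quantity for the next level and is passed on. *)
Definition find_level_body : expr :=
  EMatch (EApp (EApp groupE (EVar 4)) (EVar 0)) ENil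
    (EIf (EPrim ILe (EVar 1) (EInt 0))
      (EPair (EVar 4) (EPair (EVar 6) (EVar 0)))
      (ELet (EPrim ISub (EVar 4) (EInt 1))
        (EApp (EApp (EApp (EVar 8) (EApp (EApp stepE (EVar 0)) (EVar 7)))
          (EVar 0)) (EVar 2)))).
Definition find_levelE : expr := EFun (EFun (EFun find_level_body)).

(** The third argument starts as [eps] and doubles at every level, so that no logarithm has to be
    computed. *)
Definition refine_body : expr :=
  EIf (EPrim RLe (EVar 0) (EReal 8))
    (ELet (EPrim ISub (EVar 2) (EInt 1))
      (EApp (EApp (EApp (EVar 6) (EApp (EApp stepE (EVar 0)) (EVar 5)))
        (EVar 0)) (EPrim RMul (EVar 1) (EReal 2))))
    (EVar 4).
Definition refineE : expr := EFun (EFun (EFun refine_body)).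

Definition mem_body : expr :=
  EMatch (EVar 0) (EPrim ILe (EInt 1) (EInt 0))
    (EIf (same_point (EVar 4) (EVar 0)) (EPrim ILe (EInt 0) (EInt 0))
      (EApp (EApp (EVar 5) (EVar 4)) (EVar 1))).
Definition memE : expr := EFun (EFun mem_body).

Definition add_missing_body : expr :=
  EMatch (EVar 2) (EVar 0)
    (ELet (EApp (EApp (EApp (EVar 7) (EVar 6)) (EVar 1)) (EVar 2))
      (EIf (EApp (EApp memE (EVar 1)) (EVar 7)) (EVar 0)
        (EPair (EVar 1) (EVar 0)))).
Definition add_missingE : expr := EFun (EFun (EFun add_missing_body)).

Definition coreset_body (aug : bool) : expr :=
  EMatch (EVar 0) ENil
    (ELet (EApp (EVar 3) (EVar 1))
      (EMatch (EVar 1) ENil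
        (EMatch (EVar 0) ENil
          (ELet (EPair (EVar 0) (EVar 3))
            (EApp (EApp appendE (EVar 0))
              (if aug then
                 EApp (EApp (EApp add_missingE (EVar 0))
                   (EMatch (EVar 2) ENil
                     (EMatch (EVar 1) ENil
                       (EMatch (EVar 0) ENil (EVar 1))))) (EVar 5)
               else EVar 5)))))).
Definition coresetE (aug : bool) : expr := EFun (coreset_body aug).

Ltac eval_call ::= first
  [ match goal with IH : _ |- _ => eapply IH end
  | eapply append_evals ].

(** * Correctness and cost of the programs *)

Section Programs.
Context (R : realType) (U : metricType R) (h : heap R U).
Implicit Types (fe : seq (val R U)) (L : seq (xtree U)).

Definition enc_nodes L : val R U := enc_seq (@enc_xtree R U) L.
Definition enc_group (g : xtree U * seq U) : val R U :=
  VPair (enc_xtree R g.1) (enc_points R g.2).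
Definition enc_groups (G : seq (xtree U * seq U)) : val R U :=
  enc_seq enc_group G.

Lemma extras_evals fe (p : U) L (b : nat) :
  let E := take b [seq q <- map (@xpoint U) L | q != p] in
  evals h (env3 extras_body fe (VPoint p) (enc_nodes L) (VInt b%:Z)) extras_body
    (VPair (enc_points R E) (VInt (b - size E)%N%:Z))
    (60 * (size E + count_mem p (map (@xpoint U) L)).+1).
Proof.
elim: L b => [|[q l a ts] L IH] b /=.
  by rewrite subn0; run_body extras_body.
case: b => [|b].
  have H : (0%:Z <= 0) = true by [].
  by rewrite take0 /= subn0; run_body extras_body; simpl; lia.
have H : (b.+1%:Z <= 0) = false by lia.
have [qp|qp] := eqVneq q p.
  have Hpq : (mdist p q <= 0%:~R) = true by rewrite same_pointE qp eqxx.
  by run_body extras_body; simpl; lia.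
have Hpq : (mdist p q <= 0%:~R) = false.
  by rewrite same_pointE eq_sym (negbTE qp).
have {}IH := IH b; rewrite (_ : b%:Z = b.+1%:Z - 1) in IH; last by lia.
rewrite /= subSS.
by run_body extras_body; simpl; lia.
Qed.

Ltac eval_call ::= first
  [ match goal with IH : _ |- _ => eapply IH end
  | eapply append_evals | eapply extras_evals ].

(** Bounds the children that the scan for extras passes over without spending any budget. *)
Definition distinct_children (u : xtree U) : Prop :=
  (count_mem (xpoint u) (map (@xpoint U) (xchildren u)) <= 1)%N.

Lemma group_evals fe L (b : nat) :
  (forall u, List.In u L -> distinct_children u) ->
  evals h (env2 group_body fe (enc_nodes L) (VInt b%:Z)) group_body
    (VPair (enc_groups (group L b).1) (VInt (group L b).2%:Z))
    (300 * (size L + \sum_(g <- (group L b).1) size g.2).+1).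
Proof.
elim: L b => [|[p l a ts] L IH] b H; first by run_body group_body; rewrite //= big_nil.
have /= Hu := H _ (or_introl erefl); rewrite /distinct_children /= in Hu.
have {}IH b' := IH b' (fun u uL => H u (or_intror uL)).
run_body group_body; rewrite /= big_cons /extras /=.
set s := (\sum_(_ <- _) _)%N; set e := size (take _ _); move: Hu.
by move: s e (count _ _) (size L); lia.
Qed.

Lemma step_evals fe L (l : int) :
  evals h (env2 step_body fe (VInt l) (enc_nodes L)) step_body
    (enc_nodes (step l L)) (200 * (size L + size (step l L)).+1).
Proof.
elim: L => [|u L IH]; first by run_body step_body.
rewrite /step /= -/(step l L).
case: u => p l0 a [|[q lq aq cs] ts]; rewrite /expand /=.
  by run_body step_body; simpl; lia.
case Hl: (l <= lq).
  have Happ fe' := append_evals h (@enc_xtree R U) fe'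
    (XNode q lq aq cs :: ts) (step l L).
  by run_body step_body; rewrite ?size_cat; simpl; lia.
by run_body step_body; simpl; lia.
Qed.

Ltac eval_call ::= first
  [ match goal with IH : _ |- _ => eapply IH end
  | eapply append_evals | eapply extras_evals | eapply step_evals ].

Fixpoint descend n (l : int) L : seq (xtree U) :=
  if n is n'.+1 then descend n' (l - 1) (step (l - 1) L) else L.

(** Each visited level costs a multiple of [k]: it has fewer than [k] nodes, the budget limits the
    extras, and a next level is built only when it too has fewer than [k] nodes. *)
Lemma find_level_evals fe k N l L :
  (forall i u, (i <= N)%N -> List.In u (descend i l L) -> distinct_children u) ->
  (forall i, (i <= N)%N -> (size (descend i l L) < k)%N) ->
  (forall i, (i <= N)%N ->
    (group (descend i l L) (k - size (descend i l L))).2 =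
    (k - size (descend i.+1 l L))%N) ->
  (k <= size (descend N.+1 l L))%N ->
  let LN := descend N l L in
  evals h (env3 find_level_body fe (enc_nodes L) (VInt l)
      (VInt (k - size L)%N%:Z)) find_level_body
    (VPair (VInt (l - N%:Z)) (VPair (enc_nodes LN)
      (enc_groups (group LN (k - size LN)).1)))
    (3000 * k * N.+1).
Proof.
elim: N l L => [|N IH] l L Hd Hk Hb Hf.
  have Hd0 u : List.In u L -> distinct_children u by apply: (Hd 0%N).
  have Hk0 := Hk 0%N isT; have := Hb 0%N isT; rewrite /= in Hf Hk0 * => Hb0.
  have Hg fe' := group_evals fe' (k - size L) Hd0.
  have H0 : ((group L (k - size L)).2%:Z <= 0) = true by rewrite Hb0; lia.
  have Hc := group_count L (k - size L).
  rewrite subr0; run_body find_level_body; move: Hc.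
  by move: (\sum_(_ <- _) _)%N => s; lia.
have Hd0 u : List.In u L -> distinct_children u by apply: (Hd 0%N).
have Hk0 := Hk 0%N isT; have Hk1 := Hk 1%N isT; have Hb0 := Hb 0%N isT.
rewrite /= in Hb0 Hk0 Hk1.
have Hg fe' := group_evals fe' (k - size L) Hd0.
have Hc := group_count L (k - size L); rewrite Hb0 in Hg Hc.
have H0 : ((k - size (step (l - 1) L))%N%:Z <= 0) = false.
  by move: Hk1; move: (size _) => n nk; lia.
have {}IH := IH (l - 1) (step (l - 1) L) (fun i u iN => Hd i.+1 u iN)
  (fun i iN => Hk i.+1 iN) (fun i iN => Hb i.+1 iN) Hf.
rewrite (_ : l - N.+1%:Z = l - 1 - N%:Z); last by lia.
run_body find_level_body; move: Hc Hk0 Hk1; rewrite (mulnS _ N.+1).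
move: (\sum_(_ <- _) _)%N (3000 * k * N.+1)%N => s x.
by move: (size (step _ _)) => a; lia.
Qed.

Lemma refine_evals fe i l L (e : R) :
  (forall j, (j < i)%N -> e * 2 ^+ j <= 8) -> 8 < e * 2 ^+ i ->
  evals h (env3 refine_body fe (enc_nodes L) (VInt l) (VReal e)) refine_body
    (enc_nodes (descend i l L))
    (300 * (\sum_(0 <= j < i)
      (size (descend j l L) + size (descend j.+1 l L)).+1).+1).
Proof.
elim: i l L e => [|i IH] l L e He Hi.
  have H : (e <= 8%:~R) = false.
    by apply/negbTE; rewrite -ltNge; rewrite expr0 mulr1 in Hi.
  by run_body refine_body; rewrite big_geq.
have H : (e <= 8%:~R) = true by have := He 0%N isT; rewrite expr0 mulr1.
have {}IH := IH (l - 1) (step (l - 1) L) (e * 2%:~R).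
have {IH}/IH IH : forall j, (j < i)%N -> e * 2%:~R * 2 ^+ j <= 8.
  by move=> j ji; rewrite -mulrA -exprS; exact: He.
rewrite -mulrA -exprS in IH; have {}IH := IH Hi.
rewrite big_nat_recl //=.
run_body refine_body; simpl.
move: (\sum_(_ <= _ < _) _)%N => s.
by move: (size (step _ _)) => a; lia.
Qed.

Lemma mem_evals fe (x : U) (Q : seq U) :
  evals h (env2 mem_body fe (VPoint x) (enc_points R Q)) mem_body
    (VBool (x \in Q)) (40 * (size Q).+1).
Proof.
elim: Q => [|y Q IH]; first by run_body mem_body.
rewrite inE; have [xy|xy] := eqVneq x y.
  have Hxy : (mdist x y <= 0%:~R) = true by rewrite same_pointE xy eqxx.
  by run_body mem_body; simpl; lia.
have Hxy : (mdist x y <= 0%:~R) = false by rewrite same_pointE (negbTE xy).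
by run_body mem_body; simpl; lia.
Qed.

Lemma add_missing_evals fe (Q B acc : seq U) :
  evals h (env3 add_missing_body fe (enc_points R Q) (enc_points R B)
      (enc_points R acc)) add_missing_body
    (enc_points R ([seq x <- B | x \notin Q] ++ acc))
    (200 * (size B * (size Q).+1).+1).
Proof.
elim: B => [|x B IH]; first by run_body add_missing_body.
have Hm fe' := mem_evals fe' x Q; rewrite /=.
case Hx: (x \in Q) => /=.
  by run_body add_missing_body; simpl; lia.
by run_body add_missing_body; simpl; lia.
Qed.

Lemma coreset_evals fe aug G :
  evals h (env1 (coreset_body aug) fe (enc_groups G)) (coreset_body aug)
    (enc_points R (coreset aug G))
    (300 * (\sum_(g <- G) (size g.2).+2 *
      (if aug then size (delegates g.1) else 0).+1).+1).
Proof.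
elim: G => [|[[p l a ts] E] G IH]; first by run_body coreset_body; rewrite big_nil.
rewrite big_cons [snd _]/= [fst _]/=.
have -> : coreset aug ((XNode p l a ts, E) :: G) = (p :: E) ++
    (group_delegates aug (XNode p l a ts, E) ++ coreset aug G).
  by rewrite /coreset /= -catA.
have Happ fe' := append_evals h (@VPoint R U) fe' (p :: E)
  (group_delegates aug (XNode p l a ts, E) ++ coreset aug G).
case: aug IH Happ => IH Happ.
  have Hadd fe' := add_missing_evals fe' (p :: E)
    (delegates (XNode p l a ts)) (coreset true G).
  case: a Happ Hadd => [[n B]|] Happ Hadd.
    run_body coreset_body; move: (\sum_(_ <- _) _)%N => s.
    by simpl; nia.
  run_body coreset_body; move: (\sum_(_ <- _) _)%N => s.
  by simpl; nia.
run_body coreset_body; move: (\sum_(_ <- _) _)%N => s.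
by simpl; nia.
Qed.

End Programs.

Definition start_expr : expr :=
  EMatch (EVar 2) ENil
    (EMatch (EVar 1) ENil
      (EMatch (EVar 1) ENil
        (EMatch (EVar 1) (EVar 8)
          (EMatch (EVar 1) (EVar 0) (EVar 12))))).

(** After refinement [group] is called with budget 0, which turns the nodes into groups without
    extras. *)
Definition coreset_from (aug : bool) : expr :=
  EMatch (EVar 0) ENil
    (EMatch (EVar 1) ENil
      (EMatch (EApp (EApp (EApp find_levelE (EPair (EVar 4) ENil)) (EVar 0))
                (EPrim ISub (EVar 5) (EInt 1))) ENil
        (EMatch (EVar 1) ENil
          (EIf (EPrim RLe (EVar 10) (EReal 8))
            (EMatch (EApp (EApp groupE
                (EApp (EApp (EApp refineE (EVar 0)) (EVar 2)) (EVar 10)))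
                (EInt 0)) ENil
              (EApp (coresetE aug) (EVar 0)))
            (EApp (coresetE aug) (EVar 1)))))).

Definition input_coreset (aug : bool) : expr :=
  EIf (EPrim ILe (EVar 0) (EInt 1))
    (EMatch (EVar 2) ENil (EPair (EVar 0) ENil))
    (ELet start_expr (coreset_from aug)).

Definition main_body (aug : bool) : expr :=
  EMatch (EVar 0) ENil
    (EMatch (EVar 1) ENil
      (ELet (input_coreset aug)
        (EApp (EVar 7) (EPair (EVar 0) (EVar 1))))).

(* [A] is evaluated first, in the empty heap and environment, as in its own
   runs. *)
Definition diversity_program (aug : bool) (A : expr) : expr :=
  ELet A (EFun (main_body aug)).

Section Main.
Context (R : realType) (U : metricType R) (h : heap R U) (aug : bool).
Implicit Types (env : seq (val R U)) (t : xtree U) (k : nat) (eps : R).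

(* The root chain may be arbitrarily longer than the logarithm of the aspect
   ratio, so it is skipped. *)
Definition start_node t : xtree U := if xchildren t is [:: c] then c else t.

Definition input_env env t k eps :=
  [:: VInt k%:Z, VReal eps, enc_xtree R t & env].

Lemma start_evals env t k eps :
  evals h (input_env env t k eps) start_expr (enc_xtree R (start_node t)) 20.
Proof.
by case: t => p l a [|c [|c' cs]]; run_body start_expr.
Qed.

Ltac eval_call ::= first
  [ match goal with IH : _ |- _ => eapply IH end
  | eapply coreset_evals ].

Lemma input_coreset_single env t eps :
  evals h (input_env env t 1 eps) (input_coreset aug)
    (enc_points R [:: xpoint t]) 20.
Proof.
have H : (1%:Z <= 1) = true by [].
by case: t => p l a ts; run_body input_coreset.
Qed.

Definition descend_cost (l : int) (L : seq (xtree U)) (i : nat) : nat :=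
  \sum_(0 <= j < i) (size (descend j l L) + size (descend j.+1 l L)).+1.

Definition coreset_cost (G : seq (xtree U * seq U)) : nat :=
  \sum_(g <- G) (size g.2).+2 * (if aug then size (delegates g.1) else 0).+1.

Lemma descendD a b (l : int) (L : seq (xtree U)) :
  descend (a + b) l L = descend b (l - a%:Z) (descend a l L).
Proof.
elim: a l L => [|a IH] l L; first by rewrite subr0.
by rewrite addSn /= IH; congr descend; lia.
Qed.

Definition nodes_below (s : xtree U) (j : nat) : seq (xtree U) :=
  descend j (xlevel s) [:: s].

Section Cost.
Context (k N i : nat) (eps : R) (s : xtree U).
Local Notation l := (xlevel s).
Local Notation L := (nodes_below s).

Definition selected_groups : seq (xtree U * seq U) :=
  if eps <= 8 then (group (L (N + i)) 0).1
  else (group (L N) (k - size (L N))).1.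

Definition coreset_time : nat :=
  3000 * k * N.+1 + 300 * descend_cost (l - N%:Z) (L N) i
  + 300 * size (L (N + i)) + 300 * coreset_cost selected_groups + 2000.

Lemma coreset_from_evals env t :
  (1 < k)%N ->
  (forall j u, List.In u (L j) -> distinct_children u) ->
  (forall j, (j <= N)%N -> (size (L j) < k)%N) ->
  (forall j, (j <= N)%N ->
    (group (L j) (k - size (L j))).2 = (k - size (L j.+1))%N) ->
  (k <= size (L N.+1))%N ->
  (forall j, (j < i)%N -> eps * 2 ^+ j <= 8) -> 8 < eps * 2 ^+ i ->
  evals h (enc_xtree R s :: input_env env t k eps) (coreset_from aug)
    (enc_points R (coreset aug selected_groups)) coreset_time.
Proof.
move=> k1 Hd Hk Hb Hf Hj Hi.
have Hfind fe := @find_level_evals R U h fe k N l [:: s]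
  (fun j u _ => Hd j u) Hk Hb Hf.
rewrite /= (_ : (k - 1)%N%:Z = k%:Z - 1) in Hfind; last by lia.
have Href fe := @refine_evals R U h fe i (l - N%:Z) (L N) eps Hj Hi.
rewrite -descendD -/(L (N + i)) in Href.
have Hgrp fe := @group_evals R U h fe (L (N + i)) 0 (Hd _).
have Hcnt := group_count (L (N + i)) 0.
rewrite /coreset_time /selected_groups /coreset_cost /descend_cost.
rewrite /nodes_below in Hfind Href Hgrp Hcnt *.
case: (s) Hfind Href Hgrp Hcnt => p l0 a ts /= Hfind Href Hgrp Hcnt.
case: ifP => Heps.
  have He : (eps <= 8%:~R) = true by [].
  run_body coreset_from; move: Hcnt.
  move: (bigop _ _ _) => x; move: (bigop _ _ _) => y; move: (bigop _ _ _) => z.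
  move: (3000 * _ * _)%N => w; move: (_.2) => b; move: (size _) => c.
  by lia.
have He : (eps <= 8%:~R) = false by [].
run_body coreset_from.
move: (bigop _ _ _) => x; move: (bigop _ _ _) => y; move: (3000 * _ * _)%N => w.
by move: (size _) => c; lia.
Qed.

Lemma input_coreset_evals env t : s = start_node t ->
  (1 < k)%N ->
  (forall j u, List.In u (L j) -> distinct_children u) ->
  (forall j, (j <= N)%N -> (size (L j) < k)%N) ->
  (forall j, (j <= N)%N ->
    (group (L j) (k - size (L j))).2 = (k - size (L j.+1))%N) ->
  (k <= size (L N.+1))%N ->
  (forall j, (j < i)%N -> eps * 2 ^+ j <= 8) -> 8 < eps * 2 ^+ i ->
  evals h (input_env env t k eps) (input_coreset aug)
    (enc_points R (coreset aug selected_groups)) (coreset_time + 30).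
Proof.
move=> st k1 Hd Hk Hb Hf Hj Hi.
have H := coreset_from_evals env t k1 Hd Hk Hb Hf Hj Hi.
have Hk1 : (k%:Z <= 1) = false by lia.
have := start_evals env t k eps; rewrite -st => Hst.
eapply evals_le.
  unfold_body input_coreset; eapply evals_if_false; [evaluate|eassumption|].
  by eapply evals_let; [exact: Hst|exact: H].
by lia.
Qed.

End Cost.

End Main.

(** A run of the approximation algorithm is given only for the environment of [run]. Inversion
    isolates the evaluation of the body of its closure, which can be replayed from any calling
    environment. *)
Lemma eval_apply_inv (R : realType) (U : metricType R) (h h' : heap R U)
    (f w v : val R U) (n : nat) :
  eval h [:: f; w] (EApp (EVar 0) (EVar 1)) v h' n ->
  exists fe b n', [/\ f = VClos fe b, eval h [:: w, f & fe] b v h' n'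
    & n = n'.+3].
Proof.
move=> ev.
inversion ev as [| |? ? ? ? fe b h1 m1 w1 h2 m2 ? ? m3 ev1 ev2 ev3
  | | | | | | | | | | | |]; subst.
inversion ev1 as [? ? ? ? E1| | | | | | | | | | | | | |]; subst.
inversion ev2 as [? ? ? ? E2| | | | | | | | | | | | | |]; subst.
by case: E1 => ->; case: E2 => ->; exists fe, b, m3.
Qed.

Lemma program_run (R : realType) (U : metricType R) (aug : bool) (A : expr)
    (t : xtree U) (k : nat) (eps : R) (P C : seq U) (nA n : nat) :
  run A (VPair (enc_points R P) (VInt k%:Z)) (enc_points R C) nA ->
  (forall h env, evals h (input_env env t k eps) (input_coreset aug)
    (enc_points R P) n) ->
  exists2 n', run (diversity_program aug A)
      (VPair (enc_xtree R t) (VPair (VInt k%:Z) (VReal eps)))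
      (enc_points R C) n' & (n' <= nA + n + 30)%N.
Proof.
move=> [f [h [h' [n1 [n2 [evA evf ->]]]]]] evP.
have [env' [b [m3 [fE ev3 n2E]]]] := eval_apply_inv evf.
pose fA : val R U := VClos env' b.
rewrite fE -/fA in evA ev3.
pose main := main_body aug.
pose input : val R U := VPair (enc_xtree R t) (VPair (VInt k%:Z) (VReal eps)).
have [m evm mn] := evP h
  [:: VPair (VInt k%:Z) (VReal eps); input; VClos [:: fA] main; fA].
have evbody : eval h [:: input, VClos [:: fA] main & [:: fA]] main
    (enc_points R C) h' (1 + (1 + (m + (1 + (1 + 1).+1 + m3).+1).+1).+1).+1.
  eapply EvalMatchPair; first by constructor.
  eapply EvalMatchPair; first by constructor.
  eapply EvalLet; first exact: evm.
  eapply EvalApp; [by constructor| |exact: ev3].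
  by apply: EvalPair; constructor.
eexists.
  exists (VClos [:: fA] main), h, h'; eexists; eexists; split.
  - by eapply EvalLet; [exact: evA|constructor].
  - by eapply EvalApp; [by constructor|by constructor|exact: evbody].
  - by [].
by lia.
Qed.

(** * Skipping the chain at the root *)

Section Start.
Context (R : realType) (U : metricType R) (S : {fset U}) (T : cover_tree U).
Hypothesis hT : is_cover_tree S T.

Lemma level_singleton_below (l : int) (p : U) : l <= ct_top T ->
  ct_level T l = [fset p] -> ct_level T (l - 1) = ct_children T l p.
Proof.
move=> lt El; apply/fsetP => q; apply/idP/idP; last exact: children_level.
move=> ql; have [+ qc] := level_children hT lt ql.
by rewrite El inE => /eqP E; rewrite E in qc.
Qed.

Lemma root_chain_level (p : U) (n : nat) :
  ct_level T (ct_top T) = [fset p] ->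
  (forall j : int, ct_top T - n%:Z < j <= ct_top T ->
    ct_children T j p = [fset p]) ->
  ct_level T (ct_top T - n%:Z) = [fset p].
Proof.
move=> Et; elim: n => [|n IH] H; first by rewrite subr0.
have -> : ct_top T - n.+1%:Z = ct_top T - n%:Z - 1 by lia.
rewrite (level_singleton_below (p := p)); [by apply: H; lia|by lia|].
by apply: IH => j jn; apply: H; lia.
Qed.

(** A root that is a leaf would leave a single point in [S]. A branching root with one child would
    have itself as that child, against the definition of a branch; so only a chain is skipped. *)
Lemma start_node_explicit l (p : U) t : explicit_at T l p t ->
  l = ct_top T -> ct_level T l = [fset p] -> (1 < #|` S|)%N ->
  let s := start_node t in
  exists l', [/\ l' <= ct_top T, explicit_at T l' (xpoint s) s,
    ct_level T l' = [fset xpoint s]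
  & ct_children T l' (xpoint s) <> [fset xpoint s]].
Proof.
case=> {l p t} [l p a chs|l p a lo t lol chs N et|l p a ts N uts tsE ets] lE El S1.
- have [n nS] := level_all hT; have := fsubset_leq_card nS.
  rewrite (@root_chain_level p) -?lE ?cardfs1 => //; first by lia.
  by move=> j jn; apply: chs; lia.
- have pt := explicit_point et; rewrite /start_node /= pt.
  exists (lo - 1); split=> //; first by lia.
  have := @root_chain_level p `|(l - (lo - 1))%R|%N.
  rewrite -lE (_ : l - _ = lo - 1); last by lia.
  by apply=> // j jn; apply: chs; lia.
- suff -> : start_node (XNode p l a ts) = XNode p l a ts.
    by exists l; split=> //=; [lia|apply: ExplicitBranch].
  have pl : p \in ct_level T l by rewrite El inE.
  case: ts uts tsE N {ets} => [|c [|c' cs]] //= _ tsE []; apply/fsetP => q.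
  have := children_self hT pl; rewrite -!tsE !inE => /eqP ->.
  by [].
Qed.

(** Two points one level below the start bound the maximum distance from below, which ties the start
    to the aspect ratio. *)
Lemma start_nodeP (t : xtree U) : explicit T t -> (1 < #|` S|)%N ->
  let s := start_node t in
  [/\ xlevel s <= ct_top T, lists_level T (xlevel s) [:: s]
    & (1 < #|` ct_level T (xlevel s - 1)|)%N].
Proof.
case=> Et et S1 s.
have [l [lt es El Nl]] := start_node_explicit et erefl Et S1; rewrite -/s in es El Nl.
have sl : xpoint s \in ct_level T l by rewrite El inE.
rewrite (explicit_level es); split=> //.
  split=> //; first by move=> q; rewrite El !inE.
  by move=> u [<-|//]; exact: explicit_represents es sl.
rewrite (level_singleton_below lt El) ltnNge; apply/negP => c1.
apply: Nl; apply/esym/eqP; rewrite eqEfcard cardfs1 c1 andbT fsub1set.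
exact: (children_self hT).
Qed.

End Start.

(** * Depth of the search and size of the coreset *)

Lemma geometric_sum_le (b i : nat) : (1 < b)%N ->
  (\sum_(0 <= j < i) b ^ j.+3 <= 2 * b ^ i.+2)%N.
Proof.
move=> b1; elim: i => [|i IH]; first by rewrite big_geq.
rewrite big_nat_recr //= (expnS b i.+2); move: IH; move: (b ^ i.+2)%N => x.
by move: (\sum_(_ <= _ < _) _)%N => s; nia.
Qed.

Lemma scale_exists (R : realType) (eps : R) : 0 < eps ->
  exists i, (forall j, (j < i)%N -> eps * 2 ^+ j <= 8) /\ 8 < eps * 2 ^+ i.
Proof.
move=> e0.
have ex : exists i, 8 < eps * 2 ^+ i.
  exists (Num.truncn (8 / eps)).+1; rewrite mulrC -ltr_pdivrMr //.
  have lt := truncnS_gt (8 / eps); apply: lt_le_trans lt _.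
  by rewrite -natrX ler_nat ltnW // ltn_expl.
case: (ex_minnP ex) => i Hi imin; exists i; split=> // j ji.
by rewrite leNgt; apply/negP => /imin; rewrite leqNgt ji.
Qed.

Section Descent.
Context (R : realType) (U : metricType R) (S : {fset U}) (T : cover_tree U).
Hypothesis hT : is_cover_tree S T.

Lemma represents_distinct l (u : xtree U) :
  represents T l u -> distinct_children u.
Proof.
case=> l' [eu _ _ _]; rewrite /distinct_children.
move: eu; move: {1}(xpoint u) => p0 eu; case: l' p0 u / eu => //=.
  by move=> *; rewrite addn0 leq_b1.
by move=> l' p a ts _ uts _ _; rewrite count_uniq_mem // leq_b1.
Qed.

Lemma descendS j l (L : seq (xtree U)) :
  descend j.+1 l L = step (l - j%:Z - 1) (descend j l L).
Proof. by rewrite -addn1 descendD. Qed.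

Lemma descend_level l L j : lists_level T l L -> l <= ct_top T ->
  lists_level T (l - j%:Z) (descend j l L).
Proof.
move=> lL lt; elim: j => [|j IH]; first by rewrite subr0.
rewrite descendS (_ : l - j.+1%:Z = l - j%:Z - 1); last by lia.
by apply: (lists_level_step hT) => //; lia.
Qed.

Lemma descend_augmented indep l L j :
  (forall u, List.In u L -> @augmented U indep u) ->
  forall u, List.In u (descend j l L) -> augmented indep u.
Proof.
by move=> H; elim: j => [//|j IH]; rewrite descendS; exact: augmented_step.
Qed.

Lemma aspect_ratio_ge (p q : U) (x : R) : p \in S -> q \in S -> p != q ->
  x * inf (distances S) <= mdist p q -> (1 < #|` S|)%N -> x <= aspect_ratio S.
Proof.
move=> pS qS pq H S1; rewrite ler_pdivlMr ?(min_distance_gt0 hT) //.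
exact: le_trans H (distance_le_max pS qS pq).
Qed.

Lemma ln_aspect_ratio_ge0 : 0 <= ln (aspect_ratio S).
Proof.
have [S1|S1] := leqP #|` S| 1.
  (* Without two distinct points the aspect ratio is 0 by convention, and so is its logarithm. *)
  rewrite /aspect_ratio (_ : distances S = set0) ?sup0 ?mul0r ?ln0 //.
  apply/seteqP; split=> // d [p [q [pS qS pq _]]].
  suff : (#|` [fset p; q]| <= #|` S|)%N by rewrite cardfs2 pq; lia.
  by apply: fsubset_leq_card; apply/fsubsetP => x; rewrite !inE => /orP[]/eqP ->.
apply: ln_ge0.
have /fset0Pn[p pS] : S != fset0 by rewrite -cardfs_gt0; lia.
have /fset0Pn[q] : S `\ p != fset0.
  by move: S1; rewrite -cardfs_gt0 (cardfsD1 p) pS.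
rewrite !inE => /andP[qp qS]; rewrite eq_sym in qp.
apply: (aspect_ratio_ge pS qS qp _ S1); rewrite mul1r.
exact: (remote_edge_le pS qS qp).
Qed.

End Descent.

(** From [expR x >= 1 + x] at [- 2^-1]. It turns a depth counted in powers of two into a natural
    logarithm, at the price of a factor 2. *)
Lemma ln2_ge_half (R : realType) : 2^-1 <= ln (2 : R).
Proof.
have h : expR (- 2^-1 : R) >= 1 + (- 2^-1) by exact: expR_ge1Dx.
have e0 := expR_gt0 (2^-1 : R); rewrite expRN in h.
have e2 : expR (2^-1 : R) <= 2.
  rewrite -[leLHS]invrK -[leRHS]invrK lef_pV2 ?posrE ?invr_gt0 //.
  by apply: le_trans h; lra.
by rewrite -[leLHS]expRK ler_ln ?posrE.
Qed.

Section Search.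
Context (R : realType) (U : metricType R) (S : {fset U}) (T : cover_tree U).
Hypothesis hT : is_cover_tree S T.
Context (t : xtree U) (k : nat).
Hypothesis et : explicit T t.
Hypothesis k1 : (1 < k <= #|` S|)%N.

Let S1 : (1 < #|` S|)%N. Proof. by case/andP: k1; exact: leq_trans. Qed.
Local Notation s := (start_node t).
Local Notation l := (xlevel s).
Local Notation L := (nodes_below s).
Let sP := start_nodeP hT et S1.
Let lt : l <= ct_top T. Proof. by case: sP. Qed.

Lemma search_level j : lists_level T (l - j%:Z) (L j).
Proof. by apply: (descend_level hT) => //; case: sP. Qed.

Lemma search_size j : size (L j) = #|` ct_level T (l - j%:Z)|.
Proof. exact/lists_level_size/search_level. Qed.

Lemma search_distinct j u : List.In u (L j) -> distinct_children u.
Proof.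
by move=> uL; have [_ _ H] := search_level j; apply/represents_distinct/H.
Qed.

Lemma search_budget j : (group (L j) (k - size (L j))).2 =
  (k - size (L j.+1))%N.
Proof.
rewrite group_budget [L j.+1]descendS -/(L j).
rewrite (size_step hT (search_level j)) ?subnDA //.
by move: lt; lia.
Qed.

Lemma search_exists : exists N, (forall j, (j <= N)%N -> (size (L j) < k)%N) /\
  (k <= size (L N.+1))%N.
Proof.
have ex : exists j, (k <= size (L j))%N.
  have [n nS] := level_all hT; exists n; rewrite search_size.
  have /andP[_ kS] := k1; apply: leq_trans kS _; apply: fsubset_leq_card.
  apply/fsubsetP => q /(fsubsetP nS); apply: (level_nested hT); move: lt; lia.
case: (ex_minnP ex) => [[|N]] HN Nmin; first by have := k1; move: HN => /=; lia.
exists N; split=> // j jN; rewrite ltnNge; apply/negP => /Nmin.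
by rewrite ltnNge jN.
Qed.

(** Two points of level [l - 1] are more than [2 ^ (l - 1)] apart, while level [l - N] misses a
    point of [S], so the minimum distance is at most [2 ^ (l - N)]. The aspect ratio is thus at
    least [2 ^ (N - 1)]. *)
Lemma search_depth N : (size (L N) < k)%N ->
  (N%:R - 1) <= 2 * ln (aspect_ratio S).
Proof.
move=> Nk; have ln0 := ln_aspect_ratio_ge0 hT.
case: N Nk => [|N] Nk; first by move: ln0; lra.
have [_ _] := sP; set X := ct_level T _ => X1.
have /fset0Pn[p pX] : X != fset0 by rewrite -cardfs_gt0; lia.
have /fset0Pn[q] : X `\ p != fset0.
  by move: X1; rewrite -cardfs_gt0 (cardfsD1 p) pX.
rewrite !inE => /andP[qp qX]; have pq : p != q by rewrite eq_sym.
have sep := ct_separation hT pX qX pq.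
have min : inf (distances S) <= 2 ^ (l - N.+1%:Z).
  apply: (min_distance_le hT); last by move: lt; lia.
  by rewrite -search_size; have /andP[_] := k1; exact: leq_trans.
have : 2 ^+ N <= aspect_ratio S.
  apply: (aspect_ratio_ge hT (level_sub hT pX) (level_sub hT qX) pq _ S1).
  apply: le_trans (ltW sep);
  have -> : l - 1 = l - N.+1%:Z + N%:Z by lia.
  by rewrite pow2D mulrC ler_wpM2r // exprn_ge0.
move=> H; have : ln (2 ^+ N) <= ln (aspect_ratio S).
  by rewrite ler_ln ?posrE ?exprn_gt0 // (lt_le_trans _ H) // exprn_gt0.
rewrite lnXn // -[ln 2 *+ N]mulr_natr -[N.+1%:R]natr1.
have : 2^-1 * N%:R <= ln 2 * N%:R :> R by rewrite ler_wpM2r // ln2_ge_half.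
by lra.
Qed.

End Search.

(** * Size, cost and quality of the selected coreset *)

Section Bounds.
Context (R : realType) (U : metricType R) (S : {fset U}) (T : cover_tree U).
Hypothesis hT : is_cover_tree S T.
Context (t : xtree U) (k N i b : nat) (eps : R) (aug : bool).
Hypothesis et : explicit T t.
Hypothesis k1 : (1 < k <= #|` S|)%N.
Local Notation s := (start_node t).
Local Notation L := (nodes_below s).
Local Notation G := (selected_groups k N i eps s).
Hypothesis small : forall j, (j <= N)%N -> (size (L j) < k)%N.
Hypothesis large : (k <= size (L N.+1))%N.
Hypothesis coarse : forall j, (j < i)%N -> eps * 2 ^+ j <= 8.
Hypothesis fine : 8 < eps * 2 ^+ i.
Hypothesis hb : halving U b.
Hypothesis b1 : (1 < b)%N.
Hypothesis augS : aug -> augmented (bounded_card k S) t.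

(* [k * packing_factor] bounds the number of selected nodes; for [i = 0], that is
   [eps > 8], only the nodes above the first large level are selected. *)
Definition packing_factor : nat := if i is 0 then 1 else b ^ i.+2.
Local Notation W := packing_factor.

Let ltop : xlevel s <= ct_top T.
Proof. by case/andP: k1 => k2 kS; case: (start_nodeP hT et (leq_trans k2 kS)). Qed.

Lemma eps_le8 : (eps <= 8) = (0 < i)%N.
Proof.
case: (posnP i) => [i0|i0]; last by have := coarse i0; rewrite expr0 mulr1.
by apply/negbTE; rewrite -ltNge; move: fine; rewrite i0 expr0 mulr1.
Qed.

Lemma size_below j : (size (L (N + j)) <= k.-1 * b ^ j.+2)%N.
Proof.
rewrite (search_size hT et k1).
have -> : xlevel s - (N + j)%N%:Z = xlevel s - N%:Z - j%:Z by lia.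
apply: leq_trans (level_card hT j hb _) _; first by move: ltop; lia.
rewrite leq_mul2r -(search_size hT et k1); apply/orP; right.
by have := small (leqnn N); lia.
Qed.

Lemma size_selected : (size (L (N + i)) <= k.-1 * W)%N.
Proof.
have := size_below i; rewrite /packing_factor; case: (i) => // _.
by rewrite addn0 muln1; have := small (leqnn N); lia.
Qed.

Lemma descend_cost_le :
  (descend_cost (xlevel s - N%:Z) (L N) i <= 6 * (k * W))%N.
Proof.
case: (posnP i) => [->|i0]; first by rewrite /descend_cost big_geq.
(* Each of the two levels, and the extra unit, is at most [k * b ^ j.+3]. *)
apply: (@leq_trans (\sum_(0 <= j < i) (3 * k) * b ^ j.+3)).
  apply: leq_sum => j _; rewrite /nodes_below -!descendD -!/(L _).
  have := size_below j; have := size_below j.+1; rewrite (expnS b j.+2).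
  move: (b ^ j.+2)%N (expn_gt0 b j.+2) => x; rewrite (ltnW b1) /= => x0.
  have k0 : (0 < k)%N by move: k1; lia.
  have y1 : (k.-1 * (b * x) <= k * (b * x))%N by rewrite leq_mul ?leq_pred.
  have y2 : (k.-1 * x <= k * (b * x))%N.
    by rewrite leq_mul ?leq_pred // leq_pmull // ltnW.
  have y3 : (0 < k * (b * x))%N by rewrite !muln_gt0 k0 x0 ltnW.
  rewrite -mulnA => c1 d1; move: y1 y2 y3 c1 d1.
  by move: (k * _)%N (k.-1 * _)%N (k.-1 * _)%N (size _) (size _); lia.
rewrite -big_distrr /= /packing_factor; case: (i) i0 => // j _.
have := geometric_sum_le j.+1 b1; move: (b ^ j.+3)%N (bigop _ _ _) => x y; nia.
Qed.

Lemma selected_nodes : map fst G = L (N + i).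
Proof.
rewrite /selected_groups eps_le8; case: (posnP i) => [->|_]; rewrite group_nodes //.
by rewrite addn0.
Qed.

Lemma selected_size : (\sum_(g <- G) size g.2 + size G <= k * W)%N /\
  (size G <= k.-1 * W)%N.
Proof.
have sG : (size G <= k.-1 * W)%N.
  by rewrite -(size_map fst) selected_nodes size_selected.
split=> //; have sGE : size G = size (L (N + i)) by rewrite -(size_map fst) selected_nodes.
move: sG; rewrite sGE => sG.
rewrite /selected_groups eps_le8; case: (posnP i) => [i0|i0].
  have := group_count (L N) (k - size (L N)); rewrite (search_budget hT et k1).
  rewrite /packing_factor i0 addn0 muln1; have := small (leqnn N); move: large.
  by move: (bigop _ _ _) => x; move: (size _) => y; move: (size _) => z; lia.
have := group_count (L (N + i)) 0; have := k1; move: sG.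
by move: (bigop _ _ _) => x; move: (_.2) => z; move: (size _) W => y w; nia.
Qed.

Lemma selected_grouping : grouping T (xlevel s - (N + i)%N%:Z) G.
Proof.
rewrite /selected_groups eps_le8; case: (posnP i) => [->|i0];
  rewrite ?addn0; exact/group_grouping/(search_level hT et k1).
Qed.

Lemma selected_top : xlevel s - (N + i)%N%:Z <= ct_top T.
Proof. by move: ltop; clear; lia. Qed.

Lemma selected_augmented : aug -> forall u, List.In u (map fst G) ->
  augmented (bounded_card k S) u.
Proof.
move=> a u; rewrite selected_nodes; apply: descend_augmented => v [<-|//].
rewrite /start_node; case E: (xchildren t) => [|c [|c' cs]]; try exact: augS.
by apply: (augmented_child (augS a)); rewrite E; left.
Qed.

(** The bound [k.-1 * W] on the number of nodes, rather than [k * W], makes room for the points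
    beside the delegates. *)
Lemma selected_coreset_size :
  (size (coreset aug G) <= k ^ (if aug then 2 else 1) * W)%N.
Proof.
apply: leq_trans (size_coreset hT selected_grouping selected_top selected_augmented) _.
have [s1 s2] := selected_size.
have -> : (\sum_(g <- G) (size g.2).+1 = \sum_(g <- G) size g.2 + size G)%N.
  by rewrite -sum1_size -big_split /=; apply: eq_bigr => g _; rewrite addn1.
move: s1 s2 k1; move: (bigop _ _ _) => x; move: (size _) => y; move: W => w.
by case: (aug); rewrite ?expn1 ?muln0 -?mulnn; clear; nia.
Qed.

Lemma selected_coreset_cost :
  (coreset_cost aug G <= 4 * (k ^ (if aug then 2 else 1) * W))%N.
Proof.
have [s1 s2] := selected_size.
pose d := if aug then k else 0%N.
have : (coreset_cost aug G <=
    (\sum_(g <- G) size g.2 + size G + size G) * d.+1)%N.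
  have H g : List.In g G -> ((if aug then size (delegates g.1) else 0) <= d)%N.
    rewrite /d => gG; case: ifP => // a.
    have [_ _ ->] := coreset_delegates hT selected_grouping selected_top
      selected_augmented a gG.
    by rewrite geq_minl.
  rewrite /coreset_cost; elim: (G) H => [|g G' IH] H; first by rewrite !big_nil.
  rewrite !big_cons /=.
  have := IH (fun g gG => H g (or_intror gG)); have := H g (or_introl erefl).
  move: (bigop _ _ _) => x; move: (bigop _ _ _) => y.
  by move: (if aug then _ else _); clear; nia.
move: s1 s2 k1; rewrite /d; move: (coreset_cost _ _) => c.
move: (bigop _ _ _) => x; move: (size _) => y; move: W => w.
by case: (aug); rewrite ?expn1 ?muln1 -?mulnn; clear; nia.
Qed.

Lemma coreset_time_le : (coreset_time aug k N i eps s <=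
  3000 * k * N.+1 + 4000 * (k ^ (if aug then 2 else 1) * W) + 2000)%N.
Proof.
rewrite /coreset_time; have := descend_cost_le; have := size_selected.
have := selected_coreset_cost.
have : (k * W <= k ^ (if aug then 2 else 1) * W)%N.
  by rewrite leq_mul2r; case: (aug);
    rewrite ?expn1 ?leqnn ?orbT // -mulnn leq_pmull ?orbT //;
    have := k1; lia.
have : (k.-1 * W <= k * W)%N by rewrite leq_mul2r leq_pred orbT.
move: (coreset_cost _ _) => c; move: (descend_cost _ _ _) => d.
move: (3000 * k * N.+1)%N => e; move: (size _) => f.
by move: (k ^ _ * W)%N (k * W)%N (k.-1 * W)%N => x y z; lia.
Qed.

Lemma size_coreset_points (H : seq (xtree U * seq U)) :
  size (coreset false H) = (\sum_(g <- H) (size g.2).+1)%N.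
Proof.
rewrite /coreset size_flatten /shape -map_comp sumnE big_map.
by apply: eq_bigr => g _; rewrite /= size_cat addn0.
Qed.

(** For [i = 0] the budget leaves exactly [k] grouped points, all on level [N.+1] of the search.
    Otherwise any [k] points of that level persist, by nesting, among the nodes of level [N + i]. *)
Lemma selected_separated : exists Q : {fset U}, [/\ #|` Q| = k,
  Q `<=` ct_level T (xlevel s - N.+1%:Z) & Q `<=` [fset p in coreset aug G]].
Proof.
have noaug : false -> forall u, List.In u (map fst G) ->
  augmented (bounded_card k S) u by [].
case: (posnP i) => [i0|i0].
  exists [fset p in coreset false G]; split.
  - rewrite card_fseq undup_id; last first.
      exact: (uniq_coreset hT selected_grouping selected_top noaug).
    rewrite size_coreset_points.
    have -> : (\sum_(g <- G) (size g.2).+1 = \sum_(g <- G) size g.2 + size G)%N.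
      by rewrite -sum1_size -big_split /=; apply: eq_bigr => g _; rewrite addn1.
    rewrite -(size_map fst) selected_nodes i0 addn0 /selected_groups eps_le8 i0 /=.
    have := group_count (L N) (k - size (L N)); rewrite (search_budget hT et k1).
    have := small (leqnn N); move: large.
    by move: (bigop _ _ _) => x; move: (size _) => y; move: (size _) => z; clear; lia.
  - apply/fsubsetP => x; rewrite !inE => /flattenP[_ /mem_map_In[g gG <-]].
    rewrite mem_cat orbF => /(proj2 (group_points_uniq hT selected_grouping gG))[_].
    by rewrite i0 (_ : _ - _ - 1 = xlevel s - N.+1%:Z); last by clear; lia.
  - apply/fsubsetP => x; rewrite !inE => /flattenP[_ /mem_map_In[g gG <-]].
    by rewrite mem_cat orbF; exact: mem_coreset.
have [|Q [_ Ql cQ]] := @fsubset_extend _ fset0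
    (ct_level T (xlevel s - N.+1%:Z)) k (fsub0set _).
  by rewrite cardfs0 -(search_size hT et k1).
exists Q; split=> //; apply/fsubsetP => x /(fsubsetP Ql) xl.
have [[_ GE _] _] := selected_grouping.
have : x \in ct_level T (xlevel s - (N + i)%N%:Z).
  by apply: (level_nested hT) xl; move: i0; clear; lia.
rewrite -GE -map_comp => /mem_map_In[g gG <-]; rewrite !inE.
by apply: (mem_coreset _ gG); rewrite mem_head.
Qed.

Lemma selected_opt m : uses_augmentation m = aug ->
  let P := coreset aug G in
  div_opt m k S <= (1 + 2 * eps) * div_opt m k [fset p in P] /\
  (k <= size P)%N.
Proof.
move=> mA P.
have [Q [cQ Ql QP]] := selected_separated.
have x0 : 0 < (2 : R) ^+ i by exact: exprn_gt0.
split; last first.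
  rewrite -cQ /P -(undup_id (uniq_coreset hT selected_grouping selected_top
    selected_augmented)).
  by rewrite -card_fseq; exact: fsubset_leq_card.
rewrite /P -mA in QP *.
have augm : uses_augmentation m -> forall u, List.In u (map fst G) ->
    augmented (bounded_card k S) u by rewrite mA; exact: selected_augmented.
apply: le_trans (coreset_opt hT k1 selected_grouping selected_top augm cQ Ql QP) _.
apply: ler_wpM2r.
  apply: le_trans (div_le_opt m QP cQ).
  have /andP[k2 _] := k1.
  apply: le_trans (le_div_separated (sigma := 0) m cQ k2 _); rewrite ?mulr0 //.
  by move=> *; exact: mdist_ge0.
rewrite lerD2l -(ler_pM2r x0).
set r := _ / _.
(* The nodes lie [i - 1] levels below the separated points, so [r = 4 / 2 ^ i]; then
   [4 * r < 2 * eps] because [8 < eps * 2 ^+ i]. *)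
have rx : r * 2 ^+ i = 4.
  rewrite /r mulrAC -pow2D.
  rewrite (_ : _ + i%:Z = xlevel s - N.+1%:Z + 2%N%:Z); last by clear; lia.
  rewrite pow2D mulrAC mulfV ?mul1r ?gt_eqF ?pow2_gt0 //.
  by rewrite expr2 -natrM.
by rewrite -mulrA rx; move: fine; lra.
Qed.

End Bounds.

(** * Bounds in terms of [D] and [eps], and the complete algorithm *)

Lemma one_powR (R : realType) (x : R) : 1 `^ x = 1.
Proof. by rewrite powR1. Qed.

(** The origin of 64: for [i.+1] refinements the exponent is [i.+3], and [eps * 2 ^+ i <= 8] gives
    [2 ^+ i.+3 <= 64 / eps]. The maximum with 1 serves the case without refinement. *)
Lemma packing_factor_le (R : realType) (D eps : R) (i : nat) : 0 <= D ->
  0 < eps -> (forall j, (j < i)%N -> eps * 2 ^+ j <= 8) ->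
  (packing_factor i (Num.truncn (2 `^ D)))%:R <= Num.max 1 (64 / eps) `^ D.
Proof.
move=> D0 e0 H; rewrite /packing_factor; case: i H => [|i] H.
  rewrite -[leLHS](one_powR D) ge0_ler_powR ?nnegrE //; first by rewrite le_max ler01.
  by rewrite le_max lexx.
have b0 := powR_ge0 (2 : R) D.
apply: (@le_trans _ _ ((2 `^ D) ^+ i.+3)).
  by rewrite natrX lerXn2r ?nnegrE // truncn_le.
rewrite -powR_mulrn // -powRrM mulrC powRrM powR_mulrn //.
apply: ge0_ler_powR; rewrite ?nnegrE ?exprn_ge0 //.
  by rewrite le_max ler01.
rewrite le_max; apply/orP; right; rewrite ler_pdivlMr //.
have := H i (ltnSn i); rewrite !exprS; move: (2 ^+ i) => x; lra.
Qed.

Lemma div_singletons_opt (R : realType) (U : metricType R) m (S : {fset U}) :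
  (0 < #|` S|)%N -> div_opt m 1 S <= 0.
Proof.
move=> S0; apply: div_opt_le => // C _ /eqP/cardfs1P[p ->].
by rewrite div_singleton.
Qed.

Theorem theorem6 (R : realType) (m : measure) :
  exists2 c : R, 0 < c &
  forall A : expr, exists prog : expr,
  forall (U : metricType R) (D : R) (tA : nat -> nat)
         (S : {fset U}) (k : nat) (eps : R) (T : cover_tree U) (t : xtree U),
    doubling_dimension U D ->
    approx_algorithm U m A (alpha m)%:R tA ->
    polynomial_time tA ->
    (0 < k <= #|` S|)%N ->
    0 < eps ->
    is_cover_tree S T ->
    explicit T t ->
    (uses_augmentation m -> augmented (bounded_card k S) t) ->
    exists (C : seq U) (n : nat),
      [/\ run prog
            (VPair (enc_xtree R t) (VPair (VInt (Posz k)) (VReal eps)))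
            (enc_points R C) n,
          [/\ uniq C, {subset C <= S} & size C = k],
          div_opt m k S / ((alpha m)%:R + c * eps) <= div m [fset p in C]
        & n%:R <= c * ((tA (Num.truncn
                             ((k ^ (if uses_augmentation m then 2 else 1))%N%:R
                              * Num.max 1 (64 / eps) `^ D)))%:R
                       + k%:R * ln (aspect_ratio S))].
Proof.
(* An abstract constant, because large numerals are unary. *)
have [K HK] : exists K, (8 * 1000 <= K)%N by exists (8 * 1000)%N.
have K8 : 8 <= K%:R :> R by rewrite ler_nat (leq_trans _ HK).
(* [K] dominates the constants of the programs. The time comes to at most [3 * K] times [tA X] plus
   [2 * K] times the depth term, and the ratio requires a constant of at least
   [2 * alpha m <= 8]. *)
exists (4 * K%:R); first by lra.
move=> A; exists (diversity_program (uses_augmentation m) A).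
move=> U D tA S k eps T t [D0 dU _] hA [tmono tge _] /andP[k0 kS] e0 hT et aT.
have a0 : 0 < (alpha m)%:R :> R by case: (m).
have a4 : (alpha m)%:R <= 4 :> R by case: (m); rewrite ler_nat.
set Y := Num.max 1 _ `^ D; set e := if _ then _ else _.
have Y1 : 1 <= Y.
  by rewrite -[leLHS](one_powR D) ge0_ler_powR ?nnegrE ?le_max ?ler01 ?lexx.
set X := Num.truncn _.
have XP (w : nat) : w%:R <= Y -> (k ^ e * w <= X)%N.
  move=> wY; rewrite truncn_ge_nat; last by rewrite mulr_ge0 // (le_trans _ Y1).
  by rewrite natrM ler_wpM2l.
have lnS := ln_aspect_ratio_ge0 hT.
have lnk : 0 <= k%:R * ln (aspect_ratio S) by rewrite mulr_ge0.
have tX : X%:R <= (tA X)%:R :> R by rewrite ler_nat.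
have k0e : (0 < k ^ e)%N by rewrite expn_gt0 k0.
(* For [k = 1] the first level searched would already have [k] nodes. All measures vanish, and the
   root point alone is passed to [A]. *)
have [k1|k1] := leqP k 1.
  have kE : k = 1%N by move: k0 k1; clear; lia.
  subst k; have X1 : (1 <= X)%N by rewrite (leq_trans k0e) // -[leqLHS]muln1 XP.
  have tS : xpoint t \in S.
    by apply: (level_sub hT (l := ct_top T)); case: et => ->; rewrite inE.
  have [||C [n [runA [uC CP sC] _ nA]]] := hA [:: xpoint t] 1%N => //.
  have [n' runP n'n] := program_run runA
    (fun h env => input_coreset_single h (uses_augmentation m) env t eps).
  exists C, n'; split=> //.
  - by split=> // x /CP; rewrite inE => /eqP ->.
  - case: C sC {runA uC CP runP} => [|c [|c' C]] // _.
    rewrite (_ : [fset p in [:: c]] = [fset c]) ?div_singleton; last first.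
      by apply/fsetP => x; rewrite !inE orbF.
    rewrite mulr_le0_ge0 ?div_singletons_opt // invr_ge0.
    by rewrite addr_ge0 ?mulr_ge0 // ltW.
  have X1R : 1 <= X%:R :> R by rewrite ler1n.
  have : (n' <= tA X + 50)%N.
    by have := tmono _ _ X1; move: n'n nA => /=; lia.
  rewrite -(ler_nat R) natrD => H; apply: le_trans H _.
  have : 50 <= 50 * (tA X)%:R :> R by rewrite ler_peMr // (le_trans X1R).
  move: (tA X)%:R tX X1R K8 lnk HK => z; move: (_ * ln _) => w.
  rewrite -(ler_nat R) natrM; nra.
have k2 : (1 < k <= #|` S|)%N by rewrite k1.
have S1 := leq_trans k1 kS.
have [i [coarse fine]] := scale_exists e0.
have [N [small large]] := search_exists hT et k2.
have hb := doubling_halving dU.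
have b1 : (1 < Num.truncn (2 `^ D : R))%N.
  have /fset0Pn[p pS] : S != fset0 by rewrite -cardfs_gt0 ltnW.
  have /fset0Pn[q] : S `\ p != fset0.
    by move: S1; rewrite -cardfs_gt0 (cardfsD1 p) pS.
  by rewrite !inE => /andP[qp _]; exact: halving_ge2 hb qp.
have [opt kP] := selected_opt hT et k2 small large coarse fine aT erefl.
have szP := selected_coreset_size hT et k2 small large coarse fine hb b1 aT.
have time := coreset_time_le hT et k2 small large coarse fine hb b1 aT.
have depth := search_depth hT et k2 (small N (leqnn N)).
set G := selected_groups k N i eps (start_node t) in opt kP szP.
set P := coreset (uses_augmentation m) G in opt kP szP.
have gG := selected_grouping hT N et k2 coarse fine.
have uP : uniq P.
  exact: (uniq_coreset hT gG (selected_top hT N i et k2)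
    (selected_augmented coarse fine aT)).
have PS : {subset P <= S}.
  exact: (coreset_sub hT gG (selected_top hT N i et k2)
    (selected_augmented coarse fine aT)).
have [|C [n [runA [uC CP sC] dC nA]]] := hA P k uP; first by rewrite k0.
have evP h env := input_coreset_evals h (uses_augmentation m) env (erefl (start_node t))
  k1 (search_distinct hT et k2) small (fun j _ => search_budget hT et k2 j)
  large coarse fine.
have [n' runP n'n] := program_run runA evP.
exists C, n'; split=> //.
- by split=> // x /CP/PS.
- have C0 : 0 <= div m [fset p in C].
    apply: le_trans (le_div_separated (k := k) (sigma := 0) m _ k1 _);
      rewrite ?mulr0 ?card_fseq ?undup_id //.
    by move=> *; exact: mdist_ge0.
  rewrite ler_pdivrMr //; last by rewrite addr_gt0 // !mulr_gt0 //; lra.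
  rewrite ler_pdivrMr // in dC; apply: le_trans opt _.
  have e1 : 0 <= 1 + 2 * eps by lra.
  apply: le_trans (ler_wpM2l e1 dC) _.
  rewrite mulrCA ler_wpM2l //.
  have := ler_wpM2l (ltW e0) a4; have := ler_wpM2l (ltW e0) K8; lra.
have WY := packing_factor_le D0 e0 coarse.
have kX : (k <= X)%N.
  rewrite (leq_trans _ (XP 1%N Y1)) // muln1.
  by rewrite /e; case: ifP => _; rewrite ?expn1 // -mulnn leq_pmulr.
have {}szP : (size P <= X)%N := leq_trans szP (XP _ WY).
have {}time := leq_trans time (leq_add (leq_add (leqnn _)
  (leq_mul (leqnn 4000) (XP _ WY))) (leqnn _)).
have : (n' <= K * (k * N.+1) + K * tA X)%N.
  have := tmono _ _ szP; have := tge X; move: n'n nA time kX k0 HK.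
  rewrite -mulnA; move: (k * N.+1)%N (coreset_time _ _ _ _ _ _) (tA X) (tA (size P)).
  by clear; nia.
rewrite -(ler_nat R) natrD !natrM => H; apply: le_trans H _.
have kd : k%:R * (N%:R - 1) <= k%:R * (2 * ln (aspect_ratio S)) by rewrite ler_wpM2l.
have {}kX : k%:R <= X%:R :> R by rewrite ler_nat.
(* The depth bound concerns [N - 1]; the remaining [2 * k] is absorbed by [k <= X <= tA X]. *)
have -> : k%:R * N.+1%:R = k%:R * (N%:R - 1) + 2 * k%:R :> R.
  by rewrite -natr1; lra.
have K0 : 0 <= K%:R :> R by [].
apply: (@le_trans _ _ (K%:R * (k%:R * (2 * ln (aspect_ratio S)) + 2 * X%:R) +
  K%:R * (tA X)%:R)).
  by rewrite lerD2r ler_wpM2l //; lra.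
have : 0 <= K%:R * (k%:R * ln (aspect_ratio S)) by rewrite mulr_ge0.
have : K%:R * X%:R <= K%:R * (tA X)%:R :> R by rewrite ler_wpM2l.
have : 0 <= K%:R * X%:R :> R by rewrite mulr_ge0.
by lra.
Qed.
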